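(* Let $k$ be an odd positive integer with $k \ge 5$. Then the smallest number of turns in a near-Hamiltonian cycle of the grid graph of size $k \times k$ is $2k$. Furthermore, for all such $k$, there are exactly $16$ near-Hamiltonian cycles which attain this smallest number. These cycles are all asymmetric, and so two of them are essentially distinct.
   Context: The grid graph of size $k\times k$ has vertex set $[0;k-1]^2\subset\mathbb{Z}^2$, cells adjacent iff at Euclidean distance $1$. A near-Hamiltonian cycle of a graph is a cycle visiting all but exactly one vertex. A cycle makes a turn at a vertex $b$ if its two cycle-neighbours $u,v$ of $b$ satisfy $u-b \ne -(v-b)$ (the two incident cycle edges are perpendicular). Cycles are regarded as subgraphs. Symmetries are the eight isometries of the plane preserving the board; a cycle is asymmetric if no nonidentity symmetry maps it to itself; essentially distinct means distinct up to symmetries. *)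

(* Defs.v *)
(* MathComp world; the plane is R * R for R : realType. *)
From HB Require Import structures.
From mathcomp Require Import all_boot all_order all_algebra all_fingroup.
From mathcomp Require Import reals.

Set Implicit Arguments.
Unset Strict Implicit.
Unset Printing Implicit Defensive.

Import Order.TTheory GRing.Theory Num.Theory.
Local Open Scope ring_scope.

Definition sqnorm (A : comNzRingType) (v : A * A) : A := v.1 ^+ 2 + v.2 ^+ 2.

Definition dist (R : realType) (p q : R * R) : R := Num.sqrt (sqnorm (p - q)).

Definition plane_isometry (R : realType) (f : R * R -> R * R) : Prop :=
  forall p q, dist (f p) (f q) = dist p q.

Notation cell k := ('I_k * 'I_k)%type.

Definition pos (k : nat) (a : cell k) : int * int :=
  ((a.1 : nat)%:Z, (a.2 : nat)%:Z).

Definition plane_pos (R : realType) (k : nat) (a : cell k) : R * R :=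
  ((pos a).1%:~R, (pos a).2%:~R).

(* The squared distance of integer points is an integer, so distance 1 can be
   tested in int. *)
Definition grid_adj (k : nat) : rel (cell k) :=
  fun a b => sqnorm (pos a - pos b) == 1.

(* A subgraph without isolated vertices is encoded by its set of edges, an edge
   being an unordered pair of cells; its vertex set is then [cover E]. *)
Notation edge_set k := {set {set cell k}}.

Definition cycle_edges (k : nat) (c : seq (cell k)) : edge_set k :=
  [set [set a; next c a] | a in c].

Definition is_cycle (k : nat) (E : edge_set k) : Prop :=
  exists c : seq (cell k),
    [/\ ucycle (@grid_adj k) c, (2 < size c)%N & E = cycle_edges c].

Definition near_hamiltonian_cycle (k : nat) (E : edge_set k) : Prop :=
  is_cycle E /\ #|~: cover E| = 1%N.

Definition turn_at (k : nat) (E : edge_set k) (b : cell k) : bool :=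
  [exists u, exists v,
    [&& u != v, [set b; u] \in E, [set b; v] \in E &
        pos u - pos b != - (pos v - pos b)]].

Definition turns (k : nat) (E : edge_set k) : nat := #|[set b | turn_at E b]|.

(* A board symmetry is recorded by the permutation of the cells induced by a
   plane isometry mapping the board onto itself. For 1 < k this permutation
   determines the isometry. *)
Definition board_symmetry (R : realType) (k : nat) (s : {perm cell k}) : Prop :=
  exists2 f : R * R -> R * R, plane_isometry f &
    forall a, f (plane_pos R a) = plane_pos R (s a).

Definition edge_image (k : nat) (s : {perm cell k}) (E : edge_set k) :
  edge_set k := [set s @: e | e : {set cell k} in E].

Definition asymmetric (R : realType) (k : nat) (E : edge_set k) : Prop :=
  forall s : {perm cell k},
    board_symmetry R s -> edge_image s E = E -> s = 1%g.

Definition essentially_same (R : realType) (k : nat) (E E' : edge_set k) :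
  Prop := exists2 s : {perm cell k}, board_symmetry R s & E' = edge_image s E.

(* Main.v *)
(* A cycle alternates between horizontal and vertical segments, so its number of
   turns is twice the number of its horizontal (or vertical) segments. If every row
   contains a horizontal segment there are at least 2k turns. Otherwise some row
   consists of vertically crossed cells and, by parity, of the missing cell; then
   all other columns contain a vertical segment, and so does the column of the
   missing cell, since otherwise the eight cells around the missing one would form
   a closed loop.

   Suppose that there are exactly 2k turns. If every row and every column contained
   exactly one segment, the border would be a closed loop. So, up to transposition,
   there is a row r without horizontal segments, and every column consists of one
   vertical segment. As the border is not a closed loop, exactly one border row,
   say the last one, has two horizontal segments, while the other rows have one.
   Going from the border towards row r, the cells not yet reached by a vertical
   segment form an interval that loses exactly its two ends at each row. This
   forces the gap of the last row to be next to a corner and, up to reflection,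
   leaves two cycles. Both are double spirals, obtained inductively by cutting one
   border edge of the smaller spiral and going round the new border. That cut is
   the only missing border edge, and no nontrivial symmetry fixes it, so the two
   spirals have 8 distinct images each. *)
Require Import Defs.
From mathcomp Require Import all_boot all_order all_algebra all_fingroup.
From mathcomp Require Import reals.
From mathcomp Require Import ring zify.

Set Implicit Arguments.
Unset Strict Implicit.
Unset Printing Implicit Defensive.

(** * The half-board lemma *)

(* [lia] with the hypotheses on the edge functions cleared: their many boolean
   atoms make it very slow. *)
Ltac nlia :=
  repeat match goal with
  | X : context [?f _ _] |- _ =>
      is_var f; match type of f with nat -> nat -> bool => clear X end
  end; lia.

(** * Boolean sequences with a prescribed number of changes *)

Definition changes (f : nat -> bool) (k : nat) : nat :=
  \sum_(j < k) (f j (+) f j.+1).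

Lemma changesS f k : changes f k.+1 = changes f k + (f k (+) f k.+1).
Proof. by rewrite /changes big_ord_recr. Qed.

Lemma odd_changes f k : odd (changes f k) = f 0 (+) f k.
Proof.
elim: k => [|k IH]; first by rewrite /changes big_ord0 addbb.
by rewrite changesS oddD IH oddb; case: (f 0) (f k) (f k.+1) => [] [] [].
Qed.

(** This and the next four lemmas turn a count of changes into explicit breakpoints, a form suited
    to [lia]. From [changes1] on, the induction asks whether the last step is a change; if so, the
    preceding lemma describes the rest. *)
Lemma changes0 f k : f 0 = false -> changes f k = 0 ->
  forall j, j <= k -> f j = false.
Proof.
move=> f0; elim: k => [|k IH]; first by move=> _ [].
rewrite changesS => /eqP; rewrite addn_eq0 => /andP[/eqP /IH Hk].
by rewrite (Hk k (leqnn k)) /=; case fk: (f k.+1) => // _ j;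
  rewrite leq_eqVlt ltnS => /orP[/eqP ->|/Hk].
Qed.

Lemma changes1 f k : f 0 = false -> changes f k = 1 ->
  exists2 a, a < k & forall j, j <= k -> f j = (a < j).
Proof.
move=> f0; elim: k => [|k IH]; first by rewrite /changes big_ord0.
rewrite changesS; case E: (changes f k) => [|[|x]].
- have H := changes0 f0 E; rewrite (H k) //= add0n.
  case fk: (f k.+1) => // _; exists k => // j; rewrite leq_eqVlt ltnS => /orP[/eqP ->|jk].
    by rewrite fk ltnSn.
  by rewrite H // ltnNge jk.
- have [a ak H] := IH E; rewrite (H k) // ak; case fk: (f k.+1) => // _.
  exists a; first exact: ltnW.
  by move=> j; rewrite leq_eqVlt ltnS => /orP[/eqP ->|/H//]; rewrite fk ltnW.
- by [].
Qed.

Lemma changes2 f k : f 0 = false -> changes f k = 2 ->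
  exists a b, [/\ a < b, b < k & forall j, j <= k -> f j = (a < j <= b)].
Proof.
move=> f0; elim: k => [|k IH]; first by rewrite /changes big_ord0.
rewrite changesS; case E: (changes f k) => [|[|[|x]]].
- by case: (_ (+) _).
- have [a ak H] := changes1 f0 E; rewrite (H k) // ak.
  case fk: (f k.+1) => // _; exists a, k; split=> // j.
  rewrite leq_eqVlt ltnS => /orP[/eqP ->|jk]; first by rewrite fk ltnn andbF.
  by rewrite H // jk andbT.
- have [a [b [ab bk H]]] := IH E; rewrite (H k) // (leqNgt k b) bk andbF.
  case fk: (f k.+1) => // _; exists a, b; split=> //; first exact: ltnW.
  move=> j; rewrite leq_eqVlt ltnS => /orP[/eqP ->|/H//].
  by rewrite fk; lia.
- by [].
Qed.

Lemma changes3 f k : f 0 = false -> changes f k = 3 ->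
  exists a b c, [/\ a < b, b < c, c < k &
    forall j, j <= k -> f j = (a < j <= b) || (c < j)].
Proof.
move=> f0; elim: k => [|k IH]; first by rewrite /changes big_ord0.
rewrite changesS; case E: (changes f k) => [|[|[|[|x]]]].
- by case: (_ (+) _).
- by case: (_ (+) _).
- have [a [b [ab bk H]]] := changes2 f0 E; have Hk := H k (leqnn k).
  rewrite Hk; case fk: (f k.+1); last lia.
  move=> _.
  exists a, b, k; split=> // j; rewrite leq_eqVlt ltnS => /orP[/eqP ->|jk];
    last by rewrite H //; lia.
  by rewrite fk; lia.
- have [a [b [c [ab bc ck H]]]] := IH E; have Hk := H k (leqnn k).
  rewrite Hk; case fk: (f k.+1); last lia.
  move=> _.
  exists a, b, c; split=> //; first lia.
  by move=> j; rewrite leq_eqVlt ltnS => /orP[/eqP ->|/H//]; rewrite fk; lia.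
- by [].
Qed.

Lemma changes4 f k : f 0 = false -> changes f k = 4 ->
  exists a b c d, [/\ a < b, b < c, c < d, d < k &
    forall j, j <= k -> f j = (a < j <= b) || (c < j <= d)].
Proof.
move=> f0; elim: k => [|k IH]; first by rewrite /changes big_ord0.
rewrite changesS; case E: (changes f k) => [|[|[|[|[|x]]]]].
- by case: (_ (+) _).
- by case: (_ (+) _).
- by case: (_ (+) _).
- have [a [b [c [ab bc ck H]]]] := changes3 f0 E; have Hk := H k (leqnn k).
  rewrite Hk; case fk: (f k.+1); first lia.
  move=> _; exists a, b, c, k; split=> // j; rewrite leq_eqVlt ltnS => /orP[/eqP ->|jk];
    last by rewrite H //; lia.
  by rewrite fk; lia.
- have [a [b [c [d [ab bc cd dk H]]]]] := IH E; have Hk := H k (leqnn k).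
  rewrite Hk; case fk: (f k.+1); first lia.
  move=> _; exists a, b, c, d; split=> //; first lia.
  by move=> j; rewrite leq_eqVlt ltnS => /orP[/eqP ->|/H//]; rewrite fk; lia.
- by [].
Qed.

(* The part of the board on one side of the row [r] that carries no horizontal
   edge, its rows being numbered from the border towards [r]: [h i j] joins the
   columns [j - 1] and [j] of row [i], and [u i j] the rows [i - 1] and [i] of
   column [j]. The missing cell is [(r, c)]; the first [al] columns are vertical
   from row 1 on. *)
Record half_board (n r c al : nat) (h u : nat -> nat -> bool) : Prop := HalfBoard {
  half_r : 0 < r;
  half_c : c <= n;
  half_deg : forall i j, i < r -> j <= n ->
    h i j + h i j.+1 + u i j + u i.+1 j = 2;
  half_h0 : forall i, h i 0 = false;
  half_hn : forall i, h i n.+1 = false;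
  half_hal : h 0 al = false;
  half_u0 : forall j, u 0 j = false;
  half_mono : forall i j, i < r -> j <= n -> j != c -> u i j -> u i.+1 j;
  half_ur : forall j, j <= n -> u r j = (j != c);
  half_ual : forall i j, 0 < i <= r -> j < al -> j <= n -> u i j;
  half_row_le2 : forall i j1 j2 j3, i < r -> al <= j1 -> j1 < j2 -> j2 < j3 ->
    j3 <= n -> h i j1 != h i j1.+1 -> h i j2 != h i j2.+1 ->
    h i j3 != h i j3.+1 -> False;
  half_row_ne : forall i, i < r -> exists2 j, al < j <= n & h i j }.

Section Half.

Variables (n r c al : nat) (h u : nat -> nat -> bool).
Hypothesis hb : half_board n r c al h u.
Let r_gt0 := half_r hb.
Let c_le := half_c hb.
Let deg := half_deg hb.
Let h0 := half_h0 hb.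
Let hn := half_hn hb.
Let h_al := half_hal hb.
Let u0 := half_u0 hb.
Let u_mono := half_mono hb.
Let u_r := half_ur hb.
Let u_al := half_ual hb.
Let row_le2 := half_row_le2 hb.
Let row_ne := half_row_ne hb.

(** Invariant of the sweep from the border: the columns not yet reached by a vertical segment form
    an interval that has lost [i] columns at each end. [H i] says that row [i] runs straight across
    this interval. *)
Let P i := forall j, al <= j <= n -> u i j = ~~ (i + al <= j <= n - i).
Let H i := forall j, al <= j <= n.+1 -> h i j = (i + al < j <= n - i).

Lemma half_straight i j : i < r -> j <= n -> u i j -> u i.+1 j ->
  ~~ h i j /\ ~~ h i j.+1.
Proof.
by move=> ir jn uij uSij; have := deg ir jn; rewrite uij uSij; case: (h _ _) (h _ _) => [] [].
Qed.

Lemma half_out i j : i < r -> j <= n -> u i j -> (u i c -> u i.+1 c) ->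
  ~~ h i j /\ ~~ h i j.+1.
Proof.
move=> ir jn uij uc; apply: half_straight => //.
by case: (eqVneq j c) => [jc|jc]; [rewrite jc in uij *; exact: uc | exact: u_mono].
Qed.

(** Outside the interval the cells are vertically straight, so the ends of the interval have no
    horizontal edge outwards; each end therefore turns towards row [i.+1]. These are the two turns
    allowed by [row_le2], so everything between them is horizontal. The condition on [c] says that
    no segment of column [c] stops at row [i]. *)
Lemma half_step i : i < r -> P i -> (u i c -> u i.+1 c) ->
  [/\ i + al < n - i, P i.+1 & H i].
Proof.
move=> ir Pi uc.
have out j : al <= j <= n -> ~~ (i + al <= j <= n - i) -> ~~ h i j /\ ~~ h i j.+1.
  by move=> jn jo; apply: half_out; [ | nlia | rewrite Pi | ].
have out' j : al < j <= n.+1 -> ~~ (i + al <= j.-1 <= n - i) -> h i j = false.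
  move=> jn jo; have [||_] := out j.-1; [nlia | by [] |].
  by rewrite prednK; [move/negbTE | nlia].
have hL : h i (i + al) = false.
  case: (posnP i) => [->|i0]; first by rewrite add0n.
  have [j ij hij] := row_ne ir.
  case: (leqP (i + al) n.+1) => iLn; first by apply: out'; nlia.
  by have [] : ~~ h i j /\ ~~ h i j.+1 by [apply: out; nlia]; rewrite hij.
have lt : i + al < n - i.
  have [j ij hij] := row_ne ir; apply: contraT => ge.
  case: (boolP (i + al <= j <= n - i)) => jin; last first.
    by have [] := out j ltac:(nlia) jin; rewrite hij.
  by move: hij; rewrite out' //; nlia.
have hR : h i (n - i).+1 = false.
  case: (posnP i) => [->|i0]; first by rewrite subn0.
  have [|/= |/negbTE //] := out (n - i).+1; nlia.
have uL : u i (i + al) = false by rewrite Pi; nlia.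
have uR : u i (n - i) = false by rewrite Pi; nlia.
have [hL1 uL1] : h i (i + al).+1 /\ u i.+1 (i + al).
  have := deg ir (ltac:(nlia) : i + al <= n); rewrite hL uL.
  by case: (h _ _) (u _ _) => [] [].
have [hR1 uR1] : h i (n - i) /\ u i.+1 (n - i).
  have := deg ir (ltac:(nlia) : n - i <= n); rewrite hR uR.
  by case: (h _ _) (u _ _) => [] [].
(* A first missing edge inside the interval would make the cell to its left a third turn of the
   row. *)
have mid : forall d, i + al + d < n - i -> h i (i + al + d).+1.
  elim=> [|d IH] dlt; first by rewrite addn0.
  have hd := IH ltac:(nlia); rewrite addnS; apply: contraT => hd'; exfalso.
  apply: (@row_le2 i (i + al) (i + al + d).+1 (n - i)) => //;
    rewrite ?hL ?hL1 ?hR1 ?hR ?hd ?(negbTE hd') //; nlia.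
have mid' j : i + al < j <= n - i -> h i j.
  move=> jj; have := mid (j - (i + al)).-1 ltac:(nlia).
  by have -> : (i + al + (j - (i + al)).-1).+1 = j by nlia.
split=> //.
  move=> j jn; case: (boolP (i + al <= j <= n - i)) => jin; last first.
    have [/negbTE h1 /negbTE h2] := out j jn jin; have := deg ir (ltac:(nlia) : j <= n).
    rewrite h1 h2 Pi // jin; case: (u _ _) => // _; nlia.
  case: (eqVneq j (i + al)) => [->|jL]; first by rewrite uL1; nlia.
  case: (eqVneq j (n - i)) => [->|jR]; first by rewrite uR1; nlia.
  have := deg ir (ltac:(nlia) : j <= n); rewrite mid' ?mid'; [|nlia|nlia].
  rewrite Pi // jin; case: (u _ _) => // _; nlia.
move=> j jn; case: (boolP (i + al < j <= n - i)) => [/mid' -> //|jo].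
case: (eqVneq j (i + al)) => [-> //|jL]; case: (eqVneq j (n - i).+1) => [-> //|jR].
case: (leqP j (i + al)) => jlt.
  by have [] := out j ltac:(nlia) ltac:(nlia) => /negbTE.
by apply: out'; nlia.
Qed.

Lemma half_P0 : P 0.
Proof. by move=> j jn; rewrite u0; lia. Qed.

Lemma half_iter b : b <= r -> (forall i, i < b -> u i c -> u i.+1 c) -> P b /\
   forall i, i < b -> P i /\ H i.
Proof.
elim: b => [|b IH] br uc; first by split=> //; exact: half_P0.
have [Pb PH] := IH (ltnW br) (fun i ib => uc i (ltnW ib)).
have [_ Pb' Hb] := half_step br Pb (uc b (leqnn _)).
split=> // i; rewrite ltnS leq_eqVlt => /orP[/eqP ->|/PH //]; by split.
Qed.

Lemma half_al_c : al <= c.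
Proof.
rewrite leqNgt; apply/negP => cal.
by have := u_al (i := r) (j := c); rewrite u_r // eqxx /= r_gt0 leqnn; move/(_ isT cal c_le).
Qed.

(** Without a vertical edge in column [c] the sweep goes on up to row [r]. There the remaining
    interval can only be column [c], since all other columns cross row [r]; equating both its ends
    with [c] gives the equations. *)
Lemma half_none : (forall i, i <= r -> u i c = false) ->
  [/\ c = r + al, n = r + r + al, forall i, i <= r -> P i & forall i, i < r -> H i].
Proof.
move=> uc.
have [|Pr PH] := half_iter (leqnn r); first by move=> i ir; rewrite uc // ltnW.
have acc := half_al_c.
have := Pr c ltac:(nlia); rewrite u_r // eqxx /= => /esym/negbFE cin.
have c1 : c = r + al.
  apply/eqP; rewrite eqn_leq (andP cin).1 andbT leqNgt; apply/negP => lt.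
  have := Pr (r + al) ltac:(nlia); rewrite u_r; nlia.
have c2 : c = n - r.
  apply/eqP; rewrite eqn_leq (andP cin).2 /= leqNgt; apply/negP => lt.
  have := Pr (n - r) ltac:(nlia); rewrite u_r; nlia.
split=> //; first nlia.
  by move=> i; rewrite leq_eqVlt => /orP[/eqP -> //|/PH[]].
by move=> i /PH[].
Qed.

(** Here column [c] has a segment in this half. It starts when [c] is an end of the remaining
    interval, with only straight columns or the side of the board beyond it, and it stops by turning
    inwards. This happens in the row just before [r], when the interval has shrunk to a single
    column next to [c]. *)
Lemma half_short t b : t < b -> b < r ->
  (forall i, i <= r -> u i c = (t < i <= b)) ->
  [/\ n.+2 = r + r + al, c.+2 = r + al \/ c = r + al,
     forall i, i < r -> P i,
     forall i, i.+1 < r -> H i &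
     forall j, al <= j <= n.+1 -> h r.-1 j = (j == if c.+2 == r + al then c.+1 else c)].
Proof.
move=> tb br uc.
have acc := half_al_c.
have [|Pb PH] := half_iter (ltnW br); first by move=> i ib; rewrite !uc; nlia.
have [Pt _] := PH t tb.
have Pt' : P t.+1.
  case: (eqVneq t.+1 b) => [-> //|] ne; by case: (PH t.+1 ltac:(nlia)).
(* Column [c] belongs to the interval for [t] but not to the one for [t.+1], so it is one of the two
   ends lost in between. *)
have := Pt c ltac:(nlia); have := Pt' c ltac:(nlia).
rewrite !uc; [|nlia|nlia] => ct' ct.
have [lt _ _] := half_step (ltac:(nlia) : t < r) Pt (ltac:(rewrite !uc; nlia)).
have ubc : u b c by rewrite uc; nlia.
have uSbc : u b.+1 c = false by rewrite uc; nlia.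
have out i j : t < i < r -> j <= n -> j != c -> ~~ (t + al < j < n - t) ->
    ~~ h i j /\ ~~ h i j.+1.
  move=> ir jn jc jo.
  have uij : u i j.
    have : u t.+1 j.
      by case: (ltnP j al) => jal; [apply: u_al; nlia | rewrite Pt'; nlia].
    elim: i ir => [|i IH] ir; first by rewrite ltn0 in ir.
    case: (eqVneq t i) => [-> //|ne] uu.
    by apply: u_mono => //; [nlia | apply: IH => //; nlia].
  by apply: half_straight => //; [nlia | apply: u_mono => //; nlia].
have outb j : al <= j <= n -> j != c -> ~~ (b + al <= j <= n - b) -> ~~ h b j /\ ~~ h b j.+1.
  move=> jn jc jo; have uij : u b j by rewrite Pb.
  by apply: half_straight => //; [nlia | apply: u_mono => //; nlia].
have outb' j : al < j <= n.+1 -> j.-1 != c -> ~~ (b + al <= j.-1 <= n - b) -> h b j = false.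
  move=> jn jc jo; have [|||_] := outb j.-1; [nlia | by [] | by [] |].
  by rewrite prednK; [move/negbTE | nlia].
have dc : h b c + h b c.+1 = 1.
  by have := deg br c_le; rewrite ubc uSbc; case: (h _ _) (h _ _) => [] [].
have cc : c = t + al \/ c = n - t by nlia.
have hprev i : t < i < r -> c = t + al -> h i c = false.
  move=> ir ce; case: (posnP c) => [-> //|c0].
  have [||||_] := out i c.-1; [by [] | nlia | nlia | nlia |].
  by rewrite prednK // => /negbTE.
have hnext i : t < i < r -> c = n - t -> h i c.+1 = false.
  move=> ir ce; case: (eqVneq c n) => [-> //|c0].
  by have [||||/negbTE ] := out i c.+1; [by [] | nlia | nlia | nlia |].
have rE : r = b.+1.
  apply/eqP; rewrite eqn_leq br andbT leqNgt; apply/negP => bbr.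
  have := deg bbr c_le; rewrite uSbc (uc b.+2) //.
  case: cc => ce; first by rewrite (hprev b.+1) //; [case: (h _ _); nlia | nlia].
  by rewrite (hnext b.+1) //; [case: (h _ _); nlia | nlia].
have PH1 i : i < r -> P i by rewrite rE ltnS leq_eqVlt => /orP[/eqP -> //|/PH[]].
have PH2 i : i.+1 < r -> H i by rewrite rE ltnS => /PH[].
case: cc => ce.
- have hc : h b c = false by apply: hprev => //; nlia.
  have hc1 : h b c.+1 by move: dc; rewrite hc; case: (h _ _).
  have cn : c < n by rewrite ltn_neqAle c_le andbT; apply/eqP => cn; move: hc1; rewrite cn hn.
  have cb : b + al <= c.+1 <= n - b.
    apply: contraT => co; have [] := outb c.+1 ltac:(nlia) ltac:(nlia) co.
    by rewrite hc1.
  have hR : h b (n - b).+1 = false.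
    case: (eqVneq (n - b).+1 n.+1) => [-> //|ne].
    by have [/negbTE] := outb (n - b).+1 ltac:(nlia) ltac:(nlia) ltac:(nlia).
  (* Otherwise row [b] would turn at the three columns [c], [c.+1] and [n - b]. *)
  have cR : c.+1 = n - b.
    apply/eqP; rewrite eqn_leq (andP cb).2 /= leqNgt; apply/negP => clt.
    have uR : u b (n - b) = false by rewrite Pb; nlia.
    have hR1 : h b (n - b).
      by have := deg br (leq_subr b n); rewrite hR uR; case: (h _ _) (u _ _) => [] [].
    have uL : u b c.+1 = false by rewrite Pb; nlia.
    have uL' : u b.+1 c.+1 by rewrite -rE u_r; nlia.
    have hL : h b c.+2 = false.
      by have := deg br cn; rewrite hc1 uL uL'; case: (h _ _).
    by apply: (@row_le2 b c c.+1 (n - b)) => //; rewrite ?hc ?hc1 ?hL ?hR1 ?hR //; nlia.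
  split=> //; [nlia | left; nlia |].
  have -> : c.+2 == r + al by nlia.
  move=> j jn; rewrite rE /=.
  case: (eqVneq j c.+1) => [->|j1]; first exact: hc1.
  case: (eqVneq j c) => [->|j2] //.
  case: (ltnP j c) => jc; first by have [/negbTE] := outb j ltac:(nlia) ltac:(nlia) ltac:(nlia).
  case: (eqVneq j c.+2) => [->|j3]; last by apply: outb'; nlia.
  by rewrite cR.
- have hc : h b c.+1 = false by apply: hnext => //; nlia.
  have hc1 : h b c by move: dc; rewrite hc addn0; case: (h _ _).
  have cal : al < c by nlia.
  have cb : b + al <= c.-1 <= n - b.
    by apply: contraT => co; move: hc1; rewrite outb' //; nlia.
  have hL : h b (b + al) = false by apply: outb'; nlia.
  have cL : b + al = c.-1.
    apply/eqP; rewrite eqn_leq (andP cb).1 /= leqNgt; apply/negP => clt.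
    have uR : u b (b + al) = false by rewrite Pb; nlia.
    have hL1 : h b (b + al).+1.
      have := deg br (ltac:(nlia) : b + al <= n); rewrite hL uR.
      by case: (h _ _) (u _ _) => [] [].
    have uL : u b c.-1 = false by rewrite Pb; nlia.
    have uL' : u b.+1 c.-1 by rewrite -rE u_r; nlia.
    have cc1 : c.-1.+1 = c by nlia.
    have hR : h b c.-1 = false.
      by have := deg br (ltac:(nlia) : c.-1 <= n); rewrite cc1 hc1 uL uL'; case: (h _ _).
    by apply: (@row_le2 b (b + al) c.-1 c) => //; rewrite ?cc1 ?hL ?hL1 ?hR ?hc1 ?hc //; nlia.
  split=> //; [nlia | right; nlia |].
  have -> : (c.+2 == r + al) = false by nlia.
  move=> j jn; rewrite rE /=.
  case: (eqVneq j c.+1) => [->|j1]; first by rewrite hc; nlia.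
  case: (eqVneq j c) => [->|j2] //.
  case: (eqVneq j (b + al)) => [->|j3] //.
  case: (ltnP j (b + al)) => jc; first by have [/negbTE] :=
    outb j ltac:(nlia) ltac:(nlia) ltac:(nlia).
  by apply: outb'; nlia.
Qed.

End Half.

(** * Boards and the lower bound *)

(* [h i j] is the edge between the cells (i, j - 1) and (i, j), and [v i j] the one
   between (i - 1, j) and (i, j); rows and columns run over 0..n, and [(r, c)] is
   the missing cell. With this indexing the edges at (i, j) are [h i j],
   [h i j.+1], [v i j] and [v i.+1 j], and the turns in row [i] are the sign
   changes of [h i]. *)
Record board (n : nat) (h v : nat -> nat -> bool) (r c : nat) : Prop := Board {
  board_h : forall i j, h i j -> i <= n /\ 0 < j <= n;
  board_v : forall i j, v i j -> 0 < i <= n /\ j <= n;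
  board_r : r <= n;
  board_c : c <= n;
  board_deg2 : forall i j, i <= n -> j <= n -> (i, j) != (r, c) ->
    h i j + h i j.+1 + v i j + v i.+1 j = 2;
  board_deg0 : h r c + h r c.+1 + v r c + v r.+1 c = 0;
  board_conn : forall S : nat -> nat -> bool,
    (forall i j, i <= n -> j <= n -> S i j ->
       [/\ h i j -> S i j.-1, h i j.+1 -> S i j.+1,
           v i j -> S i.-1 j & v i.+1 j -> S i.+1 j]) ->
    forall i j i' j', i <= n -> j <= n -> i' <= n -> j' <= n ->
      (i, j) != (r, c) -> (i', j') != (r, c) -> S i j -> S i' j' }.

Definition row_turns (h : nat -> nat -> bool) (n i : nat) := changes (h i) n.+1.

(** Transposing a board exchanges its edge functions, so that [row_turns (transp v) n j] counts the
    turns in column [j] and lemmas on rows apply to columns. *)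
Definition transp (h : nat -> nat -> bool) i j := h j i.

Lemma board_transp n h v r c : board n h v r c -> board n (transp v) (transp h) c r.
Proof.
case=> bh bv br bc d2 d0 conn; split=> //; rewrite /transp.
- by move=> i j /bv[].
- by move=> i j /bh[].
- move=> i j iN jN ij; rewrite -addnA addnC addnA d2 //.
  by move: ij; rewrite !xpair_eqE andbC.
- by rewrite -addnA addnC addnA.
- move=> S Scl i j i' j' iN jN iN' jN' ij ij' Sij.
  apply: (conn (transp S) _ j i) => //; rewrite /transp.
  + by move=> a b aN bN Sab; have [] := Scl b a bN aN Sab; split.
  + by move: ij; rewrite !xpair_eqE andbC.
  + by move: ij'; rewrite !xpair_eqE andbC.
Qed.

(** Beyond the board [n - i] truncates to [0], and row [0] may have edges; hence the bound. In
    [flip_v] the index is [n.+1 - i] because [v i] joins rows [i.-1] and [i]; truncation there lands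
    on [v 0], which is false. *)
Definition flip_h n (h : nat -> nat -> bool) i j := (i <= n) && h (n - i) j.
Definition flip_v n (v : nat -> nat -> bool) i j := v (n.+1 - i) j.

Lemma board_flip n h v r c : board n h v r c ->
  board n (flip_h n h) (flip_v n v) (n - r) c.
Proof.
case=> bh bv br bc d2 d0 conn; rewrite /flip_h /flip_v; split=> //.
- by move=> i j /andP[iN /bh[]].
- by move=> i j /bv[]; nlia.
- exact: leq_subr.
- move=> i j iN jN ij; rewrite iN /= subSn // subSS -(d2 (n - i) j) ?leq_subr //;
    first by rewrite addnAC.
  by move: ij; rewrite !xpair_eqE; nlia.
- by rewrite leq_subr subSn ?leq_subr // subSS subKn //= addnAC d0.
- move=> S Scl i j i' j' iN jN iN' jN' ij ij' Sij.
  have := conn (fun i j => S (n - i) j) _ (n - i) j (n - i') j.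
  have E a : a <= n -> n - (n - a) = a by move=> aN; rewrite subKn.
  have := conn (fun i j => S (n - i) j) _ (n - i) j (n - i') j'; rewrite !E //.
  move=> H _; apply: H; rewrite ?leq_subr //.
  + move=> a b aN bN Sab; have [] := Scl (n - a) b ltac:(nlia) bN Sab.
    rewrite leq_subr subKn // !(subSn (leq_subr _ _)) subKn //= => h1 h2 h3 h4.
    split=> //.
    * move=> /[dup] /bv[a0 _] va; have := h4; rewrite subSS subKn // => /(_ va).
      by congr S; nlia.
    * move=> /[dup] /bv[a0 _] va; have := h3 va; congr S; nlia.
  + by move: ij; rewrite !xpair_eqE; nlia.
  + by move: ij'; rewrite !xpair_eqE; nlia.
Qed.

Lemma row_turns_flip n h i : i <= n -> row_turns (flip_h n h) n i = row_turns h n (n - i).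
Proof. by move=> iN; rewrite /row_turns /flip_h iN. Qed.

Lemma col_turns_flip n v j :
  row_turns (transp (flip_v n v)) n j = row_turns (transp v) n j.
Proof.
rewrite /row_turns /changes (reindex_inj rev_ord_inj) /=.
apply: eq_bigr => i _; rewrite /transp /flip_v !subSS addbC.
have iN := leq_ord i; congr (nat_of_bool (v _ _ (+) v _ _)); lia.
Qed.

Section Board.

Variables (n r c : nat) (h v : nat -> nat -> bool).
Hypothesis B : board n h v r c.
Hypothesis n_ge4 : 4 <= n.
Let deg2 := board_deg2 B.

Lemma board_h0 i : h i 0 = false.
Proof. by apply/negP => /(board_h B); rewrite ltnn andFb => -[]. Qed.

Lemma board_hn i : h i n.+1 = false.
Proof. by apply/negP => /(board_h B); rewrite ltnn andbF => -[]. Qed.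

Lemma board_v0 j : v 0 j = false.
Proof. by apply/negP => /(board_v B); rewrite ltnn andFb => -[]. Qed.

Lemma board_vn j : v n.+1 j = false.
Proof. by apply/negP => /(board_v B); rewrite ltnn andbF => -[]. Qed.

Lemma missing_isolated : [/\ h r c = false, h r c.+1 = false, v r c = false & v r.+1 c = false].
Proof. by have := board_deg0 B; case: (h _ _) (h _ _) (v _ _) (v _ _) => [] [] [] []. Qed.

(** All degrees are 2 or 0, so the horizontal and vertical degrees of a cell have the same parity.
    Turns can thus be counted along rows or along columns. *)
Lemma turn_xor i j : i <= n -> j <= n -> h i j (+) h i j.+1 = v i j (+) v i.+1 j.
Proof.
move=> iN jN; case: (eqVneq (i, j) (r, c)) => [[-> ->]|/(deg2 iN jN)].
  by have [-> -> -> ->] := missing_isolated.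
by case: (h _ _) (h _ _) (v _ _) (v _ _) => [] [] [] [].
Qed.

Lemma deg_le i j : i <= n -> j <= n -> h i j + h i j.+1 + v i j + v i.+1 j <= 2.
Proof.
move=> iN jN; case: (eqVneq (i, j) (r, c)) => [[-> ->]|/(deg2 iN jN) -> //].
by rewrite (board_deg0 B).
Qed.

Lemma straight_v i j : i <= n -> j <= n -> v i j -> v i.+1 j -> h i j = false /\ h i j.+1 = false.
Proof. by move=> iN jN vi vSi; have := deg_le iN jN; rewrite vi vSi;
  case: (h _ _) (h _ _) => [] []. Qed.

Lemma straight_h i j : i <= n -> j <= n -> h i j -> h i j.+1 -> v i j = false /\ v i.+1 j = false.
Proof. by move=> iN jN vi vSi; have := deg_le iN jN; rewrite vi vSi;
  case: (v _ _) (v _ _) => [] []. Qed.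

Lemma sum_turns : \sum_(i < n.+1) row_turns h n i = \sum_(j < n.+1) row_turns (transp v) n j.
Proof.
rewrite /row_turns /changes exchange_big; apply: eq_bigr => j _; apply: eq_bigr => i _.
by rewrite turn_xor ?leq_ord.
Qed.

Lemma row_turns_even i : odd (row_turns h n i) = false.
Proof. by rewrite /row_turns odd_changes board_h0 board_hn. Qed.

Lemma row_turns_ge2 i : row_turns h n i != 0 -> 2 <= row_turns h n i.
Proof. by have := row_turns_even i; case: (row_turns h n i) => [|[]]. Qed.

(** The crossings above and below a row have together the parity of its number of turns, which is
    even; above row [0] there are none. *)
Lemma crossings_even i : i <= n.+1 -> odd (\sum_(j < n.+1) v i j) = false.
Proof.
elim: i => [_|i IH iN]; first by rewrite big1 // => j _; rewrite board_v0.
have E : odd (\sum_(j < n.+1) v i j + \sum_(j < n.+1) v i.+1 j) = odd (row_turns h n i).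
  rewrite /row_turns /changes -big_split /= !(big_morph odd oddD (erefl : odd 0 = false)).
  by apply: eq_bigr => j _; rewrite turn_xor ?leq_ord // oddD !oddb.
by move: E; rewrite oddD IH ?row_turns_even // ltnW.
Qed.

(** A row without turns has no horizontal edge, so all its cells but the missing one are crossed
    vertically. In a row other than [r] this would be an odd number of crossings. *)
Lemma row_turns0 i : odd n.+1 -> i <= n -> row_turns h n i = 0 ->
  [/\ i = r, 0 < r < n & forall j, j <= n -> v r j = (j != c) /\ v r.+1 j = (j != c)].
Proof.
move=> nodd iN T0; have h0 := changes0 (board_h0 i) T0.
have vv j : j <= n -> (i, j) != (r, c) -> v i j /\ v i.+1 j.
  move=> jN ij; have := deg2 iN jN ij; rewrite !h0 //; last exact: ltnW.
  by case: (v _ _) (v _ _) => [] [].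
have ir : i = r.
  apply/eqP; apply/negPn/negP => ir.
  have := crossings_even (leqW iN); rewrite (eq_bigr (fun=> 1)) => [|j _].
    by rewrite sum_nat_const card_ord muln1 nodd.
  by have [|->] := vv j (leq_ord j); first by rewrite xpair_eqE (negbTE ir).
subst i; split=> //.
  have [j jN jc] : exists2 j, j <= n & j != c by case: (eqVneq 0 c) => [<-|ne]; [exists 1;
    lia|exists 0].
  have [|vr vSr] := vv j jN; first by rewrite xpair_eqE (negbTE jc) andbF.
  by have := board_v B vr; have := board_v B vSr; lia.
move=> j jN; case: (eqVneq j c) => [->|jc]; first by have [_ _ -> ->] := missing_isolated.
by have [|-> ->] := vv j jN; first by rewrite xpair_eqE (negbTE jc) andbF.
Qed.

(** A corner of the cycle is a turn, so both turns of the row are at its corners. *)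
Lemma side_full i : i = 0 \/ i = n -> row_turns h n i = 2 -> (i, 0) != (r, c) -> (i, n) != (r, c) ->
  forall j, 0 < j <= n -> h i j.
Proof.
move=> i0n T2 c0 cn.
have iN : i <= n by nlia.
have v1 j : j <= n -> v i j + v i.+1 j <= 1.
  by move=> jN; case: i0n => ->; rewrite ?board_v0 ?board_vn //; case: (v _ _).
have [a [b [ab bn E]]] := changes2 (board_h0 i) T2.
have h1 : h i 1.
  by have := deg2 iN (leq0n n) c0; have := v1 0 isT; rewrite board_h0;
    case: (h _ _) (v _ _) (v _ _) => [] [] [].
have hn : h i n.
  by have := deg2 iN (leqnn n) cn; have := v1 n (leqnn n); rewrite board_hn;
    case: (h _ _) (v _ _) (v _ _) => [] [] [].
by move=> j jn; rewrite E; move: h1 hn; rewrite ?E; nlia.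
Qed.

(** A full border is closed under adjacency, so by [board_conn] it would contain every cell of the
    cycle. *)
Lemma border_loop :
  (forall j, 0 < j <= n -> h 0 j) -> (forall j, 0 < j <= n -> h n j) ->
  (forall i, 0 < i <= n -> v i 0) -> (forall i, 0 < i <= n -> v i n) -> False.
Proof.
move=> h0 hn v0 vn.
pose S i j := [|| i == 0, i == n, j == 0 | j == n].
have Scl i j : i <= n -> j <= n -> S i j ->
     [/\ h i j -> S i j.-1, h i j.+1 -> S i j.+1, v i j -> S i.-1 j & v i.+1 j -> S i.+1 j].
  move=> iN jN; case: (boolP ((i == 0) || (i == n))) => ein.
    move=> _; case: (boolP ((j == 0) || (j == n))) => jn.
      by rewrite /S; split=> _; nlia.
    have [hj hSj] : h i j /\ h i j.+1.
      by case/orP: ein => /eqP ->; rewrite ?h0 ?hn; nlia.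
    by have [-> ->] := straight_h iN jN hj hSj; rewrite /S; split=> // _; nlia.
  rewrite /S => jn; have [vi vSi] : v i j /\ v i.+1 j.
    have /orP[/eqP ->|/eqP ->] : (j == 0) || (j == n) by nlia.
      by rewrite !v0 //; nlia.
    by rewrite !vn //; nlia.
  by have [-> ->] := straight_v iN jN vi vSi; split=> // _; nlia.
have nm : (0, 0) != (r, c).
  apply/eqP => -[er ec]; have [_ + _ _] := missing_isolated.
  by rewrite -er -ec h0 //; nlia.
have conn i j : i <= n -> j <= n -> (i, j) != (r, c) -> S i j.
  by move=> iN jN ij; apply: (board_conn B Scl (leq0n n) (leq0n n) iN jN nm ij).
have S22 : S 2 2 = false by rewrite /S; nlia.
have S11 : S 1 1 = false by rewrite /S; nlia.
(* An inner cell of the cycle gives the contradiction: [(1, 1)], or [(2, 2)] if [(1, 1)] is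
   missing. *)
case: (eqVneq (1, 1) (r, c)) => [rc|ne].
  by have : S 2 2; [apply: conn; rewrite -?rc //; nlia | rewrite S22].
by have : S 1 1; [apply: conn => //; nlia | rewrite S11].
Qed.

End Board.

Section Classify.
Variables (n r c : nat) (h v : nat -> nat -> bool).
Hypothesis B : board n h v r c.
Hypothesis n_ge4 : 4 <= n.

(* Otherwise the eight cells around the missing one form a closed loop. *)
Lemma not_both_zero : odd n.+1 -> row_turns h n r = 0 -> 0 < row_turns (transp v) n c.
Proof.
move=> nodd Tr; rewrite lt0n; apply/negP => /eqP Tc.
have [_ rn vr] := row_turns0 B n_ge4 nodd (board_r B) Tr.
have [_ cn hc] := row_turns0 (board_transp B) n_ge4 nodd (board_c B) Tc.
have hN : [/\ h r.-1 c, h r.-1 c.+1, h r.+1 c & h r.+1 c.+1].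
  rewrite /transp in hc; have := hc r.-1 ltac:(nlia); have := hc r.+1 ltac:(nlia).
  by move=> [-> ->] [-> ->]; split; nlia.
have vN : [/\ v r c.-1, v r.+1 c.-1, v r c.+1 & v r.+1 c.+1].
  have := vr c.-1 ltac:(nlia); have := vr c.+1 ltac:(nlia).
  by move=> [-> ->] [-> ->]; split; nlia.
case: hN vN => h1 h2 h3 h4 [v1 v2 v3 v4].
pose S i j := [&& r.-1 <= i <= r.+1, c.-1 <= j <= c.+1 & (i != r) || (j != c)].
have r1 : r.-1.+1 = r by nlia. have c1 : c.-1.+1 = c by nlia.
have Scl i j : i <= n -> j <= n -> S i j ->
     [/\ h i j -> S i j.-1, h i j.+1 -> S i j.+1, v i j -> S i.-1 j & v i.+1 j -> S i.+1 j].
  move=> iN jN Sij.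
  have [i3 j3] : [\/ i = r.-1, i = r | i = r.+1] /\ [\/ j = c.-1, j = c | j = c.+1].
    have near a x : a.-1 <= x <= a.+1 -> [\/ x = a.-1, x = a | x = a.+1].
      case: (ltngtP x a) => [xa|xa|->] ax; [constructor 1|constructor 3|constructor 2]; nlia.
    by move: Sij; rewrite /S => /and3P[iS jS _]; split; apply: near.
  have d := deg_le B iN jN.
  case: i3 j3 => ei [] ej; subst i j; rewrite ?r1 ?c1 ?h1 ?h2 ?h3 ?h4 ?v1 ?v2 ?v3 ?v4 in d *.
  - have [hh vv] : h r.-1 c.-1 = false /\ v r.-1 c.-1 = false.
      by move: d; case: (h _ _) (v _ _) => [] [].
    by rewrite hh vv; split=> // _; rewrite /S; nlia.
  - have [hh vv] : v r.-1 c = false /\ v r c = false.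
      by move: d; case: (v _ _) (v _ _) => [] [].
    by rewrite hh vv; split=> // _; rewrite /S; nlia.
  - have [hh vv] : h r.-1 c.+2 = false /\ v r.-1 c.+1 = false.
      by move: d; case: (h _ _) (v _ _) => [] [].
    by rewrite hh vv; split=> // _; rewrite /S; nlia.
  - have [hh vv] : h r c.-1 = false /\ h r c = false.
      by move: d; case: (h _ _) (h _ _) => [] [].
    by rewrite hh vv; split=> // _; rewrite /S; nlia.
  - by case/and3P: Sij => _ _; rewrite !eqxx.
  - have [hh vv] : h r c.+1 = false /\ h r c.+2 = false.
      by move: d; case: (h _ _) (h _ _) => [] [].
    by rewrite hh vv; split=> // _; rewrite /S; nlia.
  - have [hh vv] : h r.+1 c.-1 = false /\ v r.+2 c.-1 = false.
      by move: d; case: (h _ _) (v _ _) => [] [].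
    by rewrite hh vv; split=> // _; rewrite /S; nlia.
  - have [hh vv] : v r.+1 c = false /\ v r.+2 c = false.
      by move: d; case: (v _ _) (v _ _) => [] [].
    by rewrite hh vv; split=> // _; rewrite /S; nlia.
  - have [hh vv] : h r.+1 c.+2 = false /\ v r.+2 c.+1 = false.
      by move: d; case: (h _ _) (v _ _) => [] [].
    by rewrite hh vv; split=> // _; rewrite /S; nlia.
have conn i j : i <= n -> j <= n -> (i, j) != (r, c) -> S i j.
  have Sr : S r.+1 c by rewrite /S; nlia.
  move=> iN jN ij; apply: (board_conn B Scl _ (board_c B) iN jN _ ij Sr); first by nlia.
  by rewrite xpair_eqE; nlia.
(* A ring of side 3 cannot contain two opposite corners of the board. Neither corner is missing,
   since [r] and [c] are interior. *)
have S0 : S 0 0 by apply: conn; rewrite ?xpair_eqE //; nlia.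
have Sn : S n n by apply: conn; rewrite ?xpair_eqE //; nlia.
by move: S0 Sn; rewrite /S; nlia.
Qed.

(* If the corner is missing, row 1 turns only in its first two cells, so that
   (1, 2) is vertical and row 0 turns at (0, 1), (0, 2) and its far end. *)
Lemma corner00 : row_turns h n 0 = 2 -> row_turns h n 1 = 2 -> (r, c) != (0, 0).
Proof.
move=> T0 T1; apply/eqP => -[r0 c0]; have := missing_isolated B; rewrite r0 c0 => -[_ h01 _ v10].
have deg2 i j := board_deg2 B (i := i) (j := j); rewrite r0 c0 in deg2.
have d01 := deg2 0 1 isT ltac:(nlia) isT; rewrite h01 (board_v0 B) in d01.
have [h02 v11] : h 0 2 /\ v 1 1 by move: d01; case: (h _ _) (v _ _) => [] [].
have d10 := deg2 1 0 ltac:(nlia) isT isT; rewrite v10 (board_h0 B) in d10.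
have h11 : h 1 1 by move: d10; case: (h _ _) (v _ _) => [] [].
have d11 := deg2 1 1 ltac:(nlia) ltac:(nlia) isT; rewrite v11 h11 in d11.
have h12 : h 1 2 = false by move: d11; case: (h _ _) (v _ _) => [] [].
have [a [b [ab bn E]]] := changes2 (board_h0 B 1) T1.
have h13 : h 1 3 = false by move: h11 h12; rewrite !E; nlia.
have d12 := deg2 1 2 ltac:(nlia) ltac:(nlia) isT; rewrite h12 h13 in d12.
have v12 : v 1 2 by move: d12; case: (v _ _) (v _ _) => [] [].
have d02 := deg2 0 2 ltac:(nlia) ltac:(nlia) isT; rewrite h02 v12 (board_v0 B) in d02.
have h03 : h 0 3 = false by move: d02; case: (h _ _).
have d0n := deg2 0 n isT (leqnn n) ltac:(rewrite xpair_eqE; nlia);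
  rewrite (board_hn B) (board_v0 B) in d0n.
have h0n : h 0 n by move: d0n; case: (h _ _) (v _ _) => [] [].
have [a' [b' [ab' bn' E']]] := changes2 (board_h0 B 0) T0.
by move: h01 h02 h03 h0n; rewrite !E'; nlia.
Qed.

End Classify.

Definition two_turns n (h v : nat -> nat -> bool) :=
  forall i, i <= n -> row_turns h n i = 2 /\ row_turns (transp v) n i = 2.

Lemma two_turns_transp n h v : two_turns n h v -> two_turns n (transp v) (transp h).
Proof. by move=> H i /H[]. Qed.

Lemma two_turns_flip n h v : two_turns n h v -> two_turns n (flip_h n h) (flip_v n v).
Proof.
move=> H i iN; rewrite row_turns_flip // col_turns_flip.
by have [-> _] := H (n - i) (leq_subr _ _); have [_ ->] := H i iN.
Qed.

Lemma two_turns_corner00 n h v r c : 4 <= n -> board n h v r c -> two_turns n h v ->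
  (r, c) != (0, 0).
Proof. by move=> n4 B H; apply: (corner00 B n4); apply: (H _ _).1; nlia. Qed.

Lemma two_turns_cornern0 n h v r c : 4 <= n -> board n h v r c -> two_turns n h v ->
  (r, c) != (n, 0).
Proof.
move=> n4 B /two_turns_flip /(two_turns_corner00 n4 (board_flip B)).
by have := board_r B; rewrite !xpair_eqE; nlia.
Qed.

Lemma two_turns_corner0n n h v r c : 4 <= n -> board n h v r c -> two_turns n h v ->
  (r, c) != (0, n).
Proof.
move=> n4 B /two_turns_transp /(two_turns_cornern0 n4 (board_transp B)).
by rewrite !xpair_eqE andbC.
Qed.

Lemma two_turns_cornernn n h v r c : 4 <= n -> board n h v r c -> two_turns n h v ->
  (r, c) != (n, n).
Proof.
move=> n4 B /two_turns_flip /(two_turns_corner0n n4 (board_flip B)).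
by have := board_r B; rewrite !xpair_eqE; nlia.
Qed.

(** No corner is missing, so [side_full] fills all four sides, which [border_loop] excludes. *)
Lemma not_two_turns n h v r c : 4 <= n -> board n h v r c -> ~ two_turns n h v.
Proof.
move=> n4 B H.
have c00 := two_turns_corner00 n4 B H; have cn0 := two_turns_cornern0 n4 B H.
have c0n := two_turns_corner0n n4 B H; have cnn := two_turns_cornernn n4 B H.
have sym (a b a' b' : nat) : (a, b) != (a', b') ->
  (b', a') != (b, a) by rewrite !xpair_eqE andbC (eq_sym b') (eq_sym a').
apply: (border_loop B n4) => [j jn|j jn|i iN|i iN].
- by apply: (side_full B n4) jn; rewrite ?[_ == (r, c)]eq_sym //; [left | exact: (H 0 _).1].
- by apply: (side_full B n4) jn; rewrite ?[_ == (r, c)]eq_sym //; [right | exact: (H n _).1].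
- by apply: (side_full (board_transp B) n4 (i := 0) _ _ _ _ iN);
    [left | exact: (H 0 _).2 | exact: sym | exact: sym].
- by apply: (side_full (board_transp B) n4 (i := n) _ _ _ _ iN);
    [right | exact: (H n _).2 | exact: sym | exact: sym].
Qed.

Lemma sum_ge2 N (f : nat -> nat) : (forall i, i < N -> 2 <= f i) ->
  \sum_(i < N) f i = N.*2 + \sum_(i < N) (f i - 2).
Proof.
move=> f2; have -> : N.*2 = \sum_(i < N) 2 by rewrite sum_nat_const card_ord muln2.
by rewrite -big_split; apply: eq_bigr => i _; rewrite /= subnKC // f2.
Qed.

(** If every row turns, the rows are counted. Otherwise the columns are: those other than [c] cross
    row [r] and so turn somewhere, and column [c] is covered by [not_both_zero]. *)
Lemma turns_ge n h v r c : odd n.+1 -> 4 <= n -> board n h v r c ->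
  n.+1.*2 <= \sum_(i < n.+1) row_turns h n i.
Proof.
move=> nodd n4 B.
case: (boolP [forall i : 'I_n.+1, row_turns h n i != 0]) => [/forallP T|].
  rewrite (sum_ge2 (f := row_turns h n)) ?leq_addr // => i iN.
  exact: (row_turns_ge2 B (T (Ordinal iN))).
rewrite negb_forall => /existsP[i /negPn/eqP Ti].
have [ir rn vr] := row_turns0 B n4 nodd (leq_ord i) Ti; rewrite ir in Ti.
have Tc := not_both_zero B n4 nodd Ti.
rewrite (sum_turns B) (sum_ge2 (f := row_turns (transp v) n)) ?leq_addr // => j jN.
apply: (row_turns_ge2 (board_transp B)); case: (eqVneq j c) => [->|jc]; first by rewrite -lt0n.
apply/eqP => T0; have := changes0 (board_h0 (board_transp B) j) T0 (leqW (board_r B)).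
by rewrite /transp; have [-> _] := vr j jN; rewrite jc.
Qed.

(** * Cycles with 2k turns *)

Lemma sum_slack0 N (f : nat -> nat) : (forall i, i < N -> 2 <= f i) ->
  \sum_(i < N) f i = N.*2 -> forall i, i < N -> f i = 2.
Proof.
move=> f2 /eqP; rewrite (sum_ge2 f2) -[X in _ == X]addn0 eqn_add2l sum_nat_eq0 => /forallP H i iN.
by have := H (Ordinal iN); have := f2 i iN; rewrite /=; lia.
Qed.

Lemma sum_slack2 N (f : nat -> nat) : (forall i, i < N -> 2 <= f i) ->
  \sum_(i < N) f i = N.*2 + 2 -> forall i j, i < N -> j < N -> i != j -> f i + f j <= 6.
Proof.
move=> f2 /eqP; rewrite (sum_ge2 f2) eqn_add2l => H i j iN jN ij.
have := f2 i iN; have := f2 j jN.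
rewrite (bigD1 (Ordinal iN)) //= (bigD1 (Ordinal jN)) /= in H; first lia.
by rewrite -val_eqE eq_sym.
Qed.

(* The edges of the two normalized cycles ([d = 0, 1]) on the board of side
   [2m + 1]. They miss the cell (m + d, m + d) and differ from each other only
   around the centre. *)
Definition vform m d i j :=
  if i <= m then ~~ (i <= j <= m.*2 - i)
  else if i == m.+1 then j != m + d
  else ~~ (m.*2 + 3 - i <= j < i).

Definition hform m d i j :=
  [|| (i == m.+1 - d) && (j == m.+1), (i < m) && (i < j <= m.*2 - i),
      (m.+2 <= i) && (m.*2 - i + 2 < j <= i) | (i == m.*2) && (j == 1)].

(** * Minimal boards with a row without turns *)

Section CaseB.

Variables (n r c : nat) (h v : nat -> nat -> bool).
Hypothesis B : board n h v r c.
Hypothesis n_ge4 : 4 <= n.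
Hypothesis n_odd : odd n.+1.
Hypothesis row_r : row_turns h n r = 0.
Hypothesis total : \sum_(i < n.+1) row_turns h n i = n.+1.*2.

Lemma rowr : [/\ 0 < r, r < n & forall j, j <= n -> v r j = (j != c) /\ v r.+1 j = (j != c)].
Proof. by have [_ /andP[]] := row_turns0 B n_ge4 n_odd (board_r B) row_r. Qed.

Lemma hr_false j : h r j = false.
Proof.
case: (leqP j n.+1) => jn; first exact: (changes0 (board_h0 B r) row_r).
by apply/negP => /(board_h B)[_]; lia.
Qed.

Lemma row_ge2 i : i <= n -> i != r -> 2 <= row_turns h n i.
Proof.
move=> iN ir; apply: (row_turns_ge2 B); apply/eqP => T0.
by have [ir'] := row_turns0 B n_ge4 n_odd iN T0; rewrite ir' eqxx in ir.
Qed.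

Lemma col_two j : j <= n -> row_turns (transp v) n j = 2.
Proof.
move: j; apply: (sum_slack0 (N := n.+1)); last by rewrite -(sum_turns B).
move=> j jN; apply: (row_turns_ge2 (board_transp B)).
have [r0 rn vr] := rowr.
case: (eqVneq j c) => [->|jc]; first by rewrite -lt0n; apply: (not_both_zero B).
apply/eqP => T0; have := changes0 (board_h0 (board_transp B) j) T0 (leqW (board_r B)).
by rewrite /transp; have [-> _] := vr j jN; rewrite jc.
Qed.

Lemma row_pair i j : i <= n -> j <= n -> i != r -> j != r -> i != j ->
  row_turns h n i + row_turns h n j <= 6.
Proof.
move=> iN jN ir jr ij.
(* Row [r] is given two fictitious turns: every term is then at least 2 and the total exceeds two
   per row by 2, as [sum_slack2] requires. *)
have := @sum_slack2 n.+1 (fun i => row_turns h n i + (i == r).*2).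
move=> /(_ _ _ i j iN jN ij); rewrite (negbTE ir) (negbTE jr) !addn0; apply.
  move=> a aN; case: (eqVneq a r) => [->|ar]; first by rewrite row_r.
  by rewrite addn0; exact: row_ge2.
rewrite big_split /= total; congr addn.
rewrite (bigD1 (Ordinal (board_r B : r < n.+1))) //= eqxx big1 ?addn0 // => a.
by rewrite -val_eqE /= => /negbTE ->.
Qed.

Lemma col_int j : j <= n -> j != c -> exists a b, [/\ a < r, r < b, b <= n & forall i,
  i <= n.+1 -> v i j = (a < i <= b)].
Proof.
move=> jN jc; have [a [b [ab bn E]]] := changes2 (board_h0 (board_transp B) j) (col_two jN).
have [r0 rn vr] := rowr; exists a, b.
have := vr j jN; rewrite jc -[v r j]/(transp v j r) -[v r.+1 j]/(transp v j r.+1).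
by rewrite !E; [|nlia|nlia] => -[ra rb]; split=> //; nlia.
Qed.

(** The missing cell has no edges, so the single segment of its column stays on one side of row [r].
    This side will distinguish the two normal forms. *)
Lemma colc_int : exists a b, [/\ a < b, b <= n, b < r \/ r < a & forall i, i <= n.+1 ->
  v i c = (a < i <= b)].
Proof.
have [a [b [ab bn E]]] := changes2 (board_h0 (board_transp B) c) (col_two (board_c B)).
have [r0 rn vr] := rowr; exists a, b.
have := vr c (board_c B); rewrite eqxx -[v r c]/(transp v c r) -[v r.+1 c]/(transp v c r.+1).
by rewrite !E; [|nlia|nlia] => -[ra rb]; split=> //; nlia.
Qed.

Lemma col_side j : j = 0 \/ j = n -> forall i, 0 < i <= n -> v i j.
Proof.
have [r0 rn vr] := rowr.
move=> jn; apply: (side_full (board_transp B) n_ge4 jn); first by apply: col_two; nlia.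
  by rewrite xpair_eqE; nlia.
by rewrite xpair_eqE; nlia.
Qed.

Lemma not_both_sides : ~ (row_turns h n 0 = 2 /\ row_turns h n n = 2).
Proof.
have [r0 rn vr] := rowr.
move=> [T0 Tn]; apply: (border_loop B n_ge4);
  [| |exact: col_side (or_introl _)|exact: col_side (or_intror _)].
  by apply: (side_full B n_ge4 (or_introl erefl) T0); rewrite xpair_eqE; nlia.
by apply: (side_full B n_ge4 (or_intror erefl) Tn); rewrite xpair_eqE; nlia.
Qed.

Hypothesis row_n : row_turns h n n != 2.

(** The rows other than [r] have two turns to spare in all; by parity and [row_pair] the last row
    takes both. *)
Lemma row_n4 : row_turns h n n = 4 /\ forall i, i < n -> i != r -> row_turns h n i = 2.
Proof.
have [r0 rn vr] := rowr.
have Tn := @row_ge2 n (leqnn n) ltac:(nlia); have En := row_turns_even B n.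
have T i : i < n -> i != r -> row_turns h n n + row_turns h n i <= 6.
  by move=> iN ir; apply: row_pair => //; nlia.
have T4 : row_turns h n n >= 4.
  by move: Tn En row_n; case: (row_turns h n n) => [|[|[|[|]]]].
have T2 i : i < n -> i != r -> row_turns h n i = 2.
  by move=> iN ir; have := T i iN ir; have := @row_ge2 i (ltnW iN) ir; nlia.
split=> //; have := T 0 ltac:(nlia) ltac:(nlia); rewrite (T2 0); nlia.
Qed.

Lemma gap : exists j0, [/\ 2 <= j0, j0 < n & forall j, 0 < j <= n -> h n j = (j != j0)].
Proof.
have [r0 rn vr] := rowr.
have [Tn _] := row_n4.
have [a [b [a' [b' [ab ba ab' bn E]]]]] := changes4 (board_h0 B n) Tn.
have deg2 j : j <= n -> h n j + h n j.+1 + v n j = 2.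
  move=> jN; have := board_deg2 B (leqnn n) jN; rewrite (board_vn B) addn0; apply.
  by rewrite xpair_eqE; nlia.
have h1 : h n 1.
  by have := deg2 0 isT; rewrite (board_h0 B); case: (h _ _) (v _ _) => [] [].
have hn : h n n.
  by have := deg2 n (leqnn n); rewrite (board_hn B); case: (h _ _) (v _ _) => [] [].
have a0 : a = 0 /\ b' = n by move: h1 hn; rewrite !E; nlia.
(* A cell of the last row without horizontal edges would have degree at most one, so a single edge
   is missing between the two segments. *)
have ba' : a' = b.+1.
  apply/eqP; rewrite eqn_leq ba andbT leqNgt; apply/negP => lt.
  by have := deg2 b.+1 ltac:(nlia); rewrite !E; [|nlia|nlia]; case: (v _ _); nlia.
exists b.+1; split; [nlia | nlia |].
by move=> j jn; rewrite E; nlia.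
Qed.

(* The gap of the bottom row cannot be away from the corners: otherwise row
   [n - 1] would turn next to both its ends, so that the two columns coming up
   from the gap would cross it. *)
Lemma gap_ends j0 : 2 <= j0 -> j0 < n -> (forall j, 0 < j <= n -> h n j = (j != j0)) ->
  j0 = 2 \/ j0 = n.-1.
Proof.
move=> j2 jn hE.
have [r0 rn vr] := rowr.
have [_ T2] := row_n4.
have deg2 j : j <= n -> h n j + h n j.+1 + v n j = 2.
  move=> jN; have := board_deg2 B (leqnn n) jN; rewrite (board_vn B) addn0; apply.
  by rewrite xpair_eqE; nlia.
case: (eqVneq j0 2) => [->|ne2]; first by left.
case: (eqVneq j0 n.-1) => [->|nen]; first by right.
have v1 : v n 1 = false.
  by have := deg2 1 ltac:(nlia); rewrite !hE; [|nlia|nlia]; case: (v _ _); nlia.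
have vn1 : v n n.-1 = false.
  by have := deg2 n.-1 ltac:(nlia); rewrite !hE; [|nlia|nlia]; case: (v _ _); nlia.
have vj0 : v n j0.
  by have := deg2 j0 ltac:(nlia); rewrite !hE; [|nlia|nlia]; case: (v _ _); nlia.
have n1 : n.-1.+1 = n by nlia.
case: (eqVneq n.-1 r) => [nr|nr].
  have := vr 1 ltac:(nlia); have := vr n.-1 ltac:(nlia).
  by rewrite -nr n1 v1 vn1 => -[_ ne] [_ ne']; nlia.
have v0 := col_side (or_introl (erefl 0)); have vn := col_side (or_intror (erefl n)).
have dn j : j <= n -> h n.-1 j + h n.-1 j.+1 + v n.-1 j + v n j = 2.
  move=> jN; have := @board_deg2 _ _ _ _ _ B n.-1 j (leq_pred n) jN; rewrite n1; apply.
  by rewrite xpair_eqE; nlia.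
have h1 : h n.-1 1 = false.
  by have := dn 0 isT; rewrite !v0 ?(board_h0 B); [case: (h _ _) | nlia | nlia].
have h2 : h n.-1 2.
  by have := dn 1 ltac:(nlia); rewrite h1 v1; case: (h _ _) (v _ _) => [] [].
have hn : h n.-1 n = false.
  by have := dn n (leqnn n); rewrite !vn ?(board_hn B); [case: (h _ _) | nlia | nlia].
have hn1 : h n.-1 n.-1.
  by have := dn n.-1 (leq_pred n); rewrite n1 hn vn1; case: (h _ _) (v _ _) => [] [].
have [a [b [ab bn E]]] := changes2 (board_h0 B n.-1) (T2 n.-1 ltac:(nlia) nr).
have := dn j0 (ltnW jn); rewrite vj0.
have -> : h n.-1 j0 by move: h2 hn1; rewrite !E; nlia.
have -> : h n.-1 j0.+1 by move: h2 hn1; rewrite !E; nlia.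
by case: (v _ _).
Qed.

Hypothesis gap2 : forall j, 0 < j <= n -> h n j = (j != 2).

Lemma vn_turns j : j <= n -> v n j = [|| j == 0, j == 1, j == 2 | j == n].
Proof.
have [r0 rn vr] := rowr.
move=> jN; have := board_deg2 B (leqnn n) jN; rewrite (board_vn B) addn0.
rewrite xpair_eqE gtn_eqF // => /(_ isT).
case: (posnP j) => [->|j0]; first by rewrite (board_h0 B) gap2; [case: (v _ _); nlia | nlia].
case: (eqVneq j n) => [->|ne]; first by rewrite (board_hn B) gap2; [case: (v _ _); nlia | nlia].
by rewrite !gap2; [case: (v _ _); nlia | nlia | nlia].
Qed.

(* Otherwise the top end of column 1 would be joined to column 2, which is
   vertical there. *)
Lemma c_ne1 : c != 1.
Proof.
have [r0 rn vr] := rowr.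
apply/eqP => c1.
have [t [b [tb bn tr E]]] := colc_int; rewrite c1 in E.
have v1 : v n 1 by rewrite vn_turns; nlia.
have rt : r < t by move: v1; rewrite E; nlia.
have bE : b = n by move: v1; rewrite E; nlia.
have [a' [b' [ar rb bn' E']]] := @col_int 2 ltac:(nlia) ltac:(nlia).
have v2 : v n 2 by rewrite vn_turns; nlia.
have tN : t <= n by nlia.
have v0 := col_side (or_introl (erefl 0)).
have [_ h1] : h t 0 = false /\ h t 1 = false by apply: (straight_v B); rewrite ?v0; nlia.
have h2 : h t 2.
  have := board_deg2 B tN (ltac:(nlia) : 1 <= n); rewrite xpair_eqE h1 !E; [|nlia|nlia].
  by case: (h t 2) => // /(_ ltac:(nlia)); nlia.
have [] : h t 2 = false /\ h t 3 = false.
  by apply: (straight_v B) => //; [nlia | |]; move: v2; rewrite !E'; nlia.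
by rewrite h2.
Qed.

Lemma top_half : half_board n r c 0 h v.
Proof.
have [r0 rn vr] := rowr; have [_ T2] := row_n4.
have TT i : i < r -> row_turns h n i = 2 by move=> ir; apply: T2; nlia.
split=> //.
- exact: (board_c B).
- by move=> i j ir jn; apply: (board_deg2 B) => //; rewrite ?xpair_eqE; nlia.
- exact: (board_h0 B).
- exact: (board_hn B).
- exact: (board_h0 B).
- exact: (board_v0 B).
- move=> i j ir jn jc; have [a [b [ar rb bn E]]] := col_int jn jc.
  by rewrite !E; nlia.
- by move=> j /vr[].
- move=> i j1 j2 j3 ir _ j12 j23 j3n.
  have [a [b [ab bn E]]] := changes2 (board_h0 B i) (TT i ir).
  by rewrite !E; nlia.
- move=> i ir; have [a [b [ab bn E]]] := changes2 (board_h0 B i) (TT i ir).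
  by exists b; [nlia | rewrite E; nlia].
Qed.

Lemma col1_up i : r < i <= n -> v i 1.
Proof.
move=> irn; have [a' [b' [ar rb bn E]]] := col_int (ltac:(nlia) : 1 <= n) (ltac:(rewrite eq_sym;
  exact: c_ne1)).
have : v n 1 by rewrite vn_turns; nlia.
by rewrite !E; nlia.
Qed.

(** Seen from the last row, columns [0] and [1] are straight up to row [r], and the rest of the last
    row begins after the gap, at column [2]; hence [al] is 2. *)
Lemma bottom_half : half_board n (n - r) c 2 (flip_h n h) (flip_v n v).
Proof.
have [r0 rn vr] := rowr; have [_ T2] := row_n4.
have B' := board_flip B.
have v0 := col_side (or_introl (erefl 0)).
have TT i : 0 < i < n - r -> row_turns h n (n - i) = 2 by move=> ir; apply: T2; nlia.
split=> //.
- nlia.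
- exact: (board_c B).
- by move=> i j ir jn; apply: (board_deg2 B') => //; rewrite ?xpair_eqE; nlia.
- exact: (board_h0 B').
- exact: (board_hn B').
- by rewrite /flip_h subn0 gap2; nlia.
- exact: (board_v0 B').
- move=> i j ir jn jc; have [a [b [ar rb bn E]]] := col_int jn jc.
  by rewrite /flip_v !E; nlia.
- move=> j /vr[_ <-]; rewrite /flip_v; congr v; nlia.
- move=> i j ir j2 jn; rewrite /flip_v.
  case: (posnP j) => [->|j0]; first by apply: v0; nlia.
  by have -> : j = 1 by [nlia]; apply: col1_up; nlia.
(* The last row has four turns, but two of them are in columns [0] and [1], before [al]. *)
- move=> i j1 j2 j3 ir j12 j23 j34 j3n; rewrite /flip_h.
  have iN : i <= n by nlia.
  rewrite iN /=; case: (posnP i) => [->|i0].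
    rewrite subn0 !(@gap2 j1.+1) ?(@gap2 j1) ?(@gap2 j2) ?(@gap2 j2.+1); [|nlia..]; nlia.
  have [a [b [ab bn E]]] := changes2 (board_h0 B (n - i)) (TT i ltac:(nlia)).
  by rewrite !E; nlia.
- move=> i ir; rewrite /flip_h.
  have iN : i <= n by nlia.
  rewrite iN /=; case: (posnP i) => [->|i0].
    by exists n; [nlia | rewrite subn0 gap2; nlia].
  have [a [b [ab bn E]]] := changes2 (board_h0 B (n - i)) (TT i ltac:(nlia)).
  exists b; last by rewrite E; nlia.
  have [_ h1] : h (n - i) 0 = false /\ h (n - i) 1 = false.
    by apply: (straight_v B); rewrite ?v0; nlia.
  have [_ h2] : h (n - i) 1 = false /\ h (n - i) 2 = false.
    by apply: (straight_v B); rewrite ?col1_up; nlia.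
  have hb : h (n - i) b by rewrite E; nlia.
  case: (eqVneq b 1) => [b1|]; first by rewrite b1 h1 in hb.
  case: (eqVneq b 2) => [b2|]; first by rewrite b2 h2 in hb.
  nlia.
Qed.

End CaseB.

(** * The two normal forms *)

Section Normal.

Variables (n r c : nat) (h v : nat -> nat -> bool).
Hypothesis B : board n h v r c.
Hypothesis n_ge4 : 4 <= n.
Hypothesis n_odd : odd n.+1.
Hypothesis row_r : row_turns h n r = 0.
Hypothesis total : \sum_(i < n.+1) row_turns h n i = n.+1.*2.
Hypothesis row_n : row_turns h n n != 2.
Hypothesis gap2 : forall j, 0 < j <= n -> h n j = (j != 2).

Let vr := let: And3 _ _ H := rowr B n_ge4 n_odd row_r in H.
Let r0 := let: And3 H _ _ := rowr B n_ge4 n_odd row_r in H.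
Let rn := let: And3 _ H _ := rowr B n_ge4 n_odd row_r in H.
Let top := top_half B n_ge4 n_odd row_r total row_n.
Let bot := bottom_half B n_ge4 n_odd row_r total row_n gap2.
Let hr := hr_false B n_ge4 n_odd row_r total.

Lemma flipK_h i j : i <= n -> h i j = flip_h n h (n - i) j.
Proof. by move=> iN; rewrite /flip_h leq_subr subKn. Qed.

Lemma flipK_v i j : i <= n.+1 -> v i j = flip_v n v (n.+1 - i) j.
Proof. by move=> iN; rewrite /flip_v subKn. Qed.

(** The half-board lemmas only describe the lower half from column [2] on. This lemma and [bottom_v]
    add columns [0] and [1], and this one also the last row. *)
Lemma bottom_h m i j : n = m.*2 -> r < i <= n ->
  (2 <= j -> i < n -> h i j = (m.*2 - i + 2 < j <= i)) -> j <= n ->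
  h i j = (m.*2 - i + 2 < j <= i) || (i == m.*2) && (j == 1).
Proof.
move=> nm irn H jn; case: (eqVneq i n) => [->|iN].
  case: (posnP j) => [->|j0]; first by rewrite (board_h0 B); nlia.
  by rewrite gap2; nlia.
case: (ltnP j 2) => [j2|j2]; last by rewrite H; nlia.
case: (posnP j) => [->|j0]; first by rewrite (board_h0 B); nlia.
have v0 := col_side B n_ge4 n_odd row_r total (or_introl (erefl 0)).
have [_ h1] : h i 0 = false /\ h i 1 = false.
  by apply: (straight_v B); rewrite ?v0; nlia.
by have -> : j = 1 by [nlia]; rewrite h1; nlia.
Qed.

Lemma bottom_v m i j : n = m.*2 -> r < i <= n ->
  (2 <= j -> v i j = ~~ (m.*2 + 3 - i <= j < i)) -> j <= n ->
  v i j = ~~ (m.*2 + 3 - i <= j < i).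
Proof.
move=> nm irn H jn; case: (ltnP j 2) => [j2|/H //].
have -> : v i j; last by nlia.
case: (posnP j) => [->|j0].
  by apply: (col_side B n_ge4 n_odd row_r total (or_introl (erefl 0))); nlia.
have -> : j = 1 by nlia.
by apply: (col1_up B n_ge4 n_odd row_r total row_n gap2); nlia.
Qed.

(** The half containing the segment of column [c] falls under [half_short], the other under
    [half_none], and their equations together determine [r] and [c]. A segment above row [r] gives
    [d = 1], one below gives [d = 0]. *)
Lemma normal_form : exists m d, [/\ n = m.*2, d <= 1, (r, c) = (m + d, m + d) &
  forall i j, i <= n -> j <= n -> h i j = hform m d i j /\ v i j = vform m d i j].
Proof.
have [a [b [ab bn [br|ra] E]]] := colc_int B n_ge4 n_odd row_r total.
- have [|e1 e2 P H L] := half_short top ab br; first by move=> i ir; rewrite E; nlia.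
  have [|f1 f2 P' H'] := half_none bot; first by move=> i ir; rewrite /flip_v E; nlia.
  have [m nm] : exists m, n = m.*2 by exists n./2; nlia.
  exists m, 1; split=> //; [by congr pair; nlia|] => i j iN jN.
  have rm : r = m.+1 by nlia.
  have cm : c = m.+1 by nlia.
  have -> : vform m 1 i j = v i j.
    rewrite /vform; case: (leqP i m) => im; first by rewrite P; nlia.
    case: eqP => [->|ne]; first by rewrite -rm; have [-> _] := vr jN; rewrite cm addn1.
    symmetry; apply: bottom_v => // [|j2]; first nlia.
    by rewrite flipK_v ?P'; nlia.
  split=> //; rewrite /hform subn1 /=.
  case: (ltngtP i r) => ir.
  + case: (eqVneq i m) => [im|im].
      have := L j ltac:(nlia); have -> : (c.+2 == r + 0) = false by nlia.
      by rewrite rm im /= => ->; nlia.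
    by rewrite H; nlia.
  + rewrite (bottom_h nm) //; [nlia | nlia |] => j2 ni.
    by rewrite flipK_h // H'; nlia.
  + by rewrite ir hr; nlia.
(* Turned upside down, the segment [a < i <= b] becomes [n - b < i <= n - a]. *)
- have [|||e1 e2 P H L] := @half_short _ _ _ _ _ _ bot (n - b) (n - a);
    [nlia | nlia | by move=> i ir; rewrite /flip_v E; nlia |].
  have [|f1 f2 P' H'] := half_none top; first by move=> i ir; rewrite E; nlia.
  have [m nm] : exists m, n = m.*2 by exists n./2; nlia.
  exists m, 0; split=> //; [by congr pair; nlia|] => i j iN jN.
  have rm : r = m by nlia.
  have cm : c = m by nlia.
  have -> : vform m 0 i j = v i j.
    rewrite /vform; case: (leqP i m) => im; first by rewrite P'; nlia.
    case: eqP => [->|ne]; first by rewrite -rm; have [_ ->] := vr jN; rewrite cm rm addn0.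
    symmetry; apply: bottom_v => // [|j2]; first nlia.
    by rewrite flipK_v ?P; nlia.
  split=> //; rewrite /hform subn0 /=.
  case: (ltngtP i r) => ir.
  + by rewrite H'; nlia.
  + case: (eqVneq i m.+1) => [im|im].
      case: (ltnP j 2) => j2; last first.
        rewrite flipK_h //; have := L j ltac:(nlia).
        have -> : (c.+2 == n - r + 2) = true by nlia.
        have -> : (n - r).-1 = n - i by nlia.
        by move=> ->; nlia.
      rewrite (bottom_h nm) //; [nlia | nlia |] => j2' ni; nlia.
    rewrite (bottom_h nm) //; [nlia | nlia |] => j2 ni.
    by rewrite flipK_h // H; nlia.
  + by rewrite ir hr; nlia.
Qed.

End Normal.

(** * Cycles of cells *)

Import Order.TTheory GRing.Theory Num.Theory.

Lemma sqnorm_int1 (x y : int) : (x ^+ 2 + y ^+ 2 == 1)%R =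
  [|| (x == 0) && (y == 1), (x == 0) && (y == -1), (x == 1) && (y == 0) | (x == -1) && (y == 0)]%R.
Proof. apply/eqP/idP; nia. Qed.

Lemma grid_adjE k (a b : cell k) : grid_adj a b =
  [|| (a.1 == b.1 :> nat) && (a.2.+1 == b.2), (a.1 == b.1 :> nat) && (b.2.+1 == a.2),
      (a.2 == b.2 :> nat) && (a.1.+1 == b.1) | (a.2 == b.2 :> nat) && (b.1.+1 == a.1)].
Proof. by rewrite /grid_adj /sqnorm sqnorm_int1 /=; lia. Qed.

Lemma eq_set2 (T : finType) (a b c d : T) : [set a; b] = [set c; d] ->
  (a = c /\ b = d) \/ (a = d /\ b = c).
Proof.
move=> E.
have /set2P Ha : a \in [set c; d] by rewrite -E set21.
have /set2P Hb : b \in [set c; d] by rewrite -E set22.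
have /set2P Hc : c \in [set a; b] by rewrite E set21.
have /set2P Hd : d \in [set a; b] by rewrite E set22.
intuition congruence.
Qed.

Section Cells.

Variable n : nat.
Implicit Types (E : edge_set n.+1) (a b x : cell n.+1).

Definition cl (i j : nat) : cell n.+1 := (inord i, inord j).

Lemma clK a : cl a.1 a.2 = a.
Proof. by case: a => a1 a2; rewrite /cl !inord_val. Qed.

Lemma cl1 i j : i <= n -> (cl i j).1 = i :> nat.
Proof. by move=> iN; rewrite inordK. Qed.

Lemma cl2 i j : j <= n -> (cl i j).2 = j :> nat.
Proof. by move=> iN; rewrite inordK. Qed.

Lemma cell_eqE a b : (a == b) = (a.1 == b.1 :> nat) && (a.2 == b.2 :> nat).
Proof. by case: a b => [a1 a2] [b1 b2]. Qed.

Lemma cl_eq i j i' j' : i <= n -> j <= n -> i' <= n -> j' <= n ->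
  (cl i j == cl i' j') = (i == i') && (j == j').
Proof. by move=> *; rewrite cell_eqE !cl1 ?cl2. Qed.

(** The bounds matter: [inord] sends indices outside the board to [0], and the predecessor of [0] is
    [0], so that the set of two cells could otherwise be a different edge or a single cell. *)
Definition hE E i j := [&& i <= n, 0 < j, j <= n & [set cl i j.-1; cl i j] \in E].
Definition vE E i j := [&& 0 < i, i <= n, j <= n & [set cl i.-1 j; cl i j] \in E].

Definition grid E := forall a b, [set a; b] \in E -> grid_adj a b.

Lemma nbrP E i j x : grid E -> i <= n -> j <= n -> [set cl i j; x] \in E ->
  [\/ x = cl i j.-1 /\ hE E i j, x = cl i j.+1 /\ hE E i j.+1,
      x = cl i.-1 j /\ vE E i j | x = cl i.+1 j /\ vE E i.+1 j].
Proof.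
move=> gE iN jN xE; have := gE _ _ xE; rewrite grid_adjE !cl1 // ?cl2 //.
have x1 : x.1 <= n := leq_ord _; have x2 : x.2 <= n := leq_ord _.
case/or4P=> /andP[/eqP e1 /eqP e2]; [constructor 2|constructor 1|constructor 4|constructor 3].
- have ex : x = cl i j.+1 by rewrite -[LHS]clK -e1 -e2.
  by split=> //; rewrite /hE iN e2 x2 /= -e2 -ex.
- have ex : x = cl i j.-1 by rewrite -[LHS]clK -e1 -e2.
  by split=> //; rewrite /hE iN jN -ex setUC xE -e2.
- have ex : x = cl i.+1 j by rewrite -[LHS]clK -e1 -e2.
  by split=> //; rewrite /vE jN e2 x1 /= -e2 -ex.
- have ex : x = cl i.-1 j by rewrite -[LHS]clK -e1 -e2.
  by split=> //; rewrite /vE iN jN -ex setUC xE -e2.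
Qed.

Lemma hE_nbrl E i j : hE E i j -> [set cl i j; cl i j.-1] \in E.
Proof. by rewrite setUC => /and4P[]. Qed.
Lemma hE_nbrr E i j : hE E i j.+1 -> [set cl i j; cl i j.+1] \in E.
Proof. by case/and4P. Qed.
Lemma vE_nbru E i j : vE E i j -> [set cl i j; cl i.-1 j] \in E.
Proof. by rewrite setUC => /and4P[]. Qed.
Lemma vE_nbrd E i j : vE E i.+1 j -> [set cl i j; cl i.+1 j] \in E.
Proof. by case/and4P. Qed.

Lemma card_nbr E i j : grid E -> i <= n -> j <= n ->
  #|[set x | [set cl i j; x] \in E]| = hE E i j + hE E i j.+1 + vE E i j + vE E i.+1 j.
Proof.
move=> gE iN jN.
pose L := nseq (hE E i j) (cl i j.-1) ++ nseq (hE E i j.+1) (cl i j.+1) ++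
          nseq (vE E i j) (cl i.-1 j) ++ nseq (vE E i.+1 j) (cl i.+1 j).
have LE : [set x | [set cl i j; x] \in E] =i L.
  move=> x; rewrite inE !mem_cat !mem_nseq !lt0b; apply/idP/idP.
    by case/(nbrP gE iN jN) => -[-> ->]; rewrite eqxx ?orbT.
  case/or4P=> /andP[H /eqP ->]; [exact: hE_nbrl|exact: hE_nbrr|exact: vE_nbru|exact: vE_nbrd].
have LU : uniq L.
  have b1 : hE E i j -> 0 < j by case/and4P.
  have b2 : hE E i j.+1 -> j < n by case/and4P.
  have b3 : vE E i j -> 0 < i by case/and4P.
  have b4 : vE E i.+1 j -> i < n by case/and4P.
  move: b1 b2 b3 b4; rewrite /L; case: (hE E i j) (hE E i j.+1) (vE E i j) (vE E i.+1 j) => []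
    [] [] [] /=;
  move=> *; rewrite ?inE ?cl_eq; lia.
rewrite (eq_card LE) (card_uniqP LU) /L !size_cat !size_nseq; lia.
Qed.

Definition cycle_on E (s : seq (cell n.+1)) :=
  [/\ ucycle (@grid_adj n.+1) s, 2 < size s & E = cycle_edges s].

Lemma next_next_neq (T : eqType) (s : seq T) (x : T) : uniq s -> 2 < size s -> x \in s ->
  next s (next s x) != x.
Proof.
move=> Us s2 /rot_to[i t Et].
rewrite -(next_rot i Us) -(next_rot i Us) Et.
have : uniq (rot i s) by rewrite rot_uniq.
have : 2 < size (rot i s) by rewrite size_rot.
rewrite Et; case: t {Et} => [|y [|z t]] //= _; rewrite eqxx !inE !negb_or => /andP[/and3P[xy xz _]].
by rewrite [y == x]eq_sym (negbTE xy) eqxx => _; rewrite eq_sym.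
Qed.

Lemma cycle_nbr E s a x : cycle_on E s -> a \in s ->
  ([set a; x] \in E) = (x \in [set next s a; prev s a]).
Proof.
case=> /andP[_ Us] _ -> as_; rewrite in_set2; apply/imsetP/orP.
  case=> y ys /eq_set2[[-> ->]|[-> ->]]; first by left.
  by right; rewrite prev_next.
case=> /eqP ->; first by exists a.
by exists (prev s a); rewrite ?mem_prev // next_prev // setUC.
Qed.

Lemma cycle_grid E s : cycle_on E s -> grid E.
Proof.
case=> /andP[Cs Us] _ -> a b /imsetP[x xs /eq_set2[[-> ->]|[-> ->]]].
  exact: next_cycle Cs xs.
by have := next_cycle Cs xs; rewrite !grid_adjE; lia.
Qed.

Lemma cycle_cover E s : cycle_on E s -> cover E =i s.
Proof.
case=> _ _ -> x; rewrite /cover; apply/bigcupP/idP.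
  by case=> _ /imsetP[y ys ->] /set2P[->|->] //; rewrite mem_next.
by move=> xs; exists [set x; next s x]; rewrite ?set21 //; apply/imsetP; exists x.
Qed.

Lemma card_cycle_nbr E s a : cycle_on E s -> a \in s ->
  #|[set x | [set a; x] \in E]| = 2.
Proof.
move=> C as_; have -> : [set x | [set a; x] \in E] = [set next s a; prev s a].
  by apply/setP => x; rewrite inE (cycle_nbr x C as_).
case: C => /andP[_ Us] s2 _; rewrite cards2; apply/eqP; rewrite eqSS eqb1.
by apply/eqP => e; have := next_next_neq Us s2 as_; rewrite e next_prev ?eqxx.
Qed.

Lemma no_nbr E a x : a \notin cover E -> ([set a; x] \in E) = false.
Proof. by move=> aE; apply/negP => H; case/bigcupP: aE; exists [set a; x]; rewrite ?set21. Qed.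

Lemma cycle_connected E s (S : pred (cell n.+1)) : cycle_on E s ->
  (forall a b, S a -> [set a; b] \in E -> S b) ->
  forall a b, a \in s -> b \in s -> S a -> S b.
Proof.
move=> C Scl a b as_ bs Sa; case: (C) => /andP[_ Us] _ _.
have : fconnect (next s) a b by rewrite (fconnect_cycle (cycle_next Us)).
case/connectP => p; elim: p a as_ Sa => [|y p IH] a as_ Sa /=; first by move=> _ ->.
case/andP=> /eqP <- pp; apply: IH => //; first by rewrite mem_next.
by apply: Scl Sa _; rewrite (cycle_nbr _ C as_) set21.
Qed.

(** Passage from cells to indices. A cell of the cycle has degree 2 because its neighbours are its
    images under [next] and [prev], which differ on more than two cells; connectedness comes from
    iterating [next]. *)
Lemma board_of_cycle E : near_hamiltonian_cycle E ->
  exists r c, board n (hE E) (vE E) r c.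
Proof.
move=> [[s C0] H1]; have C : cycle_on E s := C0.
have gE := cycle_grid C.
have [x0 x0E] : exists x0, ~: cover E = [set x0] by apply/cards1P; rewrite H1.
have inE_s a : (a \in s) = (a != x0).
  by rewrite -(cycle_cover C) -[_ \in cover E]negbK -in_setC x0E inE.
have ins i j : i <= n -> j <= n -> (i, j) != (x0.1 : nat, x0.2 : nat) -> cl i j \in s.
  by move=> iN jN ij; rewrite inE_s cell_eqE cl1 // ?cl2 // -xpair_eqE.
have r1 : x0.1 <= n := leq_ord _; have c1 : x0.2 <= n := leq_ord _.
exists x0.1, x0.2; split=> //.
- by move=> i j /and4P[-> -> ->].
- by move=> i j /and4P[-> -> ->].
- by move=> i j iN jN ij; rewrite -card_nbr // (card_cycle_nbr C) // ins.
- rewrite -card_nbr // clK; apply: eq_card0 => x; rewrite inE no_nbr //.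
  by rewrite (cycle_cover C) inE_s eqxx.
- move=> S Scl i j i' j' iN jN iN' jN' ij ij' Sij.
  have := @cycle_connected E s (fun a => S a.1 a.2) C _ (cl i j) (cl i' j').
  rewrite !cl1 // ?cl2 //; apply=> //; try exact: ins.
  move=> a b Sa; rewrite -(clK a) => /(nbrP gE (leq_ord _) (leq_ord _)).
  have [h1 h2 h3 h4] := Scl _ _ (leq_ord a.1) (leq_ord a.2) Sa.
  have pn k : k <= n -> k.-1 <= n by apply: leq_trans (leq_pred _).
  case=> -[-> hv]; have /and4P[k1 k2 k3 _] := hv; rewrite cl1 ?cl2 ?pn ?leq_ord //.
  - exact: h1. - exact: h2. - exact: h3. - exact: h4.
Qed.

Lemma grid_ext E E' : (forall e, e \in E -> exists a b, e = [set a; b]) ->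
  (forall e, e \in E' -> exists a b, e = [set a; b]) -> grid E -> grid E' ->
  (forall i j, i <= n -> j <= n -> hE E i j = hE E' i j /\ vE E i j = vE E' i j) -> E = E'.
Proof.
move=> e1 e2 g1 g2 H.
have sub (F F' : edge_set n.+1) : (forall e, e \in F -> exists a b, e = [set a; b]) -> grid F ->
    (forall i j, i <= n -> j <= n -> hE F i j = hE F' i j /\ vE F i j = vE F' i j) -> F \subset F'.
  move=> eF gF HF; apply/subsetP => e /[dup] /eF[a [b ->]].
  rewrite -(clK a) => /(nbrP gF (leq_ord _) (leq_ord _)).
  case=> -[-> hv]; have := hv; case/and4P => *; move: hv.
  - by have [-> _] := HF a.1 a.2 (leq_ord _) (leq_ord _); exact: hE_nbrl.
  - by have [-> _] := HF a.1 a.2.+1 (leq_ord _) ltac:(assumption); exact: hE_nbrr.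
  - by have [_ ->] := HF a.1 a.2 (leq_ord _) (leq_ord _); exact: vE_nbru.
  - by have [_ ->] := HF a.1.+1 a.2 ltac:(assumption) (leq_ord _); exact: vE_nbrd.
apply/eqP; rewrite eqEsubset !sub // => i j iN jN; have [-> ->] := H i j iN jN; by split.
Qed.

Lemma turn_atE E r c a : board n (hE E) (vE E) r c -> grid E ->
  turn_at E a = hE E a.1 a.2 (+) hE E a.1 a.2.+1.
Proof.
move=> B gE; have [i1 i2] := (leq_ord a.1, leq_ord a.2).
have X := turn_xor B i1 i2.
apply/existsP/idP.
  have pn k : k <= n -> k.-1 <= n by apply: leq_trans (leq_pred _).
  case=> u /existsP[w /and4P[uw uE wE]]; apply: contraR => hx.
  have vx : ~~ (vE E a.1 a.2 (+) vE E a.1.+1 a.2) by rewrite -X.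
  have dl := deg_le B i1 i2.
  move: uE wE uw; rewrite -(clK a) => /(nbrP gE i1 i2) Hu /(nbrP gE i1 i2) Hw.
  (* A horizontal and a vertical edge together would, by the parities, force all four edges, against
     [deg_le]. Two opposite neighbours satisfy the equation of a straight passage. *)
  case: Hu => -[-> hu]; case: Hw => -[-> hw]; rewrite ?eqxx // => _;
  have /and4P[k1 k2 k3 _] := hu; have /and4P[l1 l2 l3 _] := hw;
  first [by exfalso; move: hx vx dl hu hw;
    case: (hE E a.1 a.2) (hE E a.1 a.2.+1) (vE E a.1 a.2) (vE E a.1.+1 a.2) => [] [] [] []
  | rewrite /pos !cl1 ?cl2 ?pn ?leq_ord //= -pair_eqE /=; clear -k1 k2 l1 l2; lia].
move=> hx; have vx : vE E a.1 a.2 (+) vE E a.1.+1 a.2 by rewrite -X.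
have [u [uE u1 u2]] : exists u, [/\ [set a; u] \in E, u.1 = a.1 :> nat & u.2 != a.2 :> nat].
  case/orP: (ltac:(by move: hx; case: (hE _ _ _) (hE _ _ _) => [] []) : hE E a.1 a.2 || hE E a.1
    a.2.+1) => h.
    exists (cl a.1 a.2.-1); split; first by have := hE_nbrl h; rewrite clK.
      by rewrite cl1.
    by case/and4P: h => *; rewrite cl2; lia.
  exists (cl a.1 a.2.+1); split; first by have := hE_nbrr h; rewrite clK.
    by rewrite cl1.
  by case/and4P: h => *; rewrite cl2; lia.
have [w [wE w2 w1]] : exists w, [/\ [set a; w] \in E, w.2 = a.2 :> nat & w.1 != a.1 :> nat].
  case/orP: (ltac:(by move: vx; case: (vE _ _ _) (vE _ _ _) => [] []) : vE E a.1 a.2 || vE E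
    a.1.+1 a.2) => h.
    exists (cl a.1.-1 a.2); split; first by have := vE_nbru h; rewrite clK.
      by rewrite cl2.
    by case/and4P: h => *; rewrite cl1; lia.
  exists (cl a.1.+1 a.2); split; first by have := vE_nbrd h; rewrite clK.
    by rewrite cl2.
  by case/and4P: h => *; rewrite cl1; lia.
exists u; apply/existsP; exists w; apply/and4P; split=> //.
  by rewrite cell_eqE w2 negb_and u2 orbT.
rewrite /pos -pair_eqE /= u1 w2; move: u2 w1; clear.
move: (nat_of_ord u.2) (nat_of_ord w.1) (nat_of_ord a.1) (nat_of_ord a.2); lia.
Qed.

Lemma turns_rows E r c : board n (hE E) (vE E) r c -> grid E ->
  turns E = \sum_(i < n.+1) row_turns (hE E) n i.
Proof.
move=> B gE; rewrite /turns /row_turns /changes pair_big /= -sum1_card big_mkcond /=.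
by apply: eq_bigr => a _; rewrite inE (turn_atE _ B gE); case: (_ (+) _).
Qed.

Definition near_min E := near_hamiltonian_cycle E /\ turns E = 2 * n.+1.

(** Integer counterpart of [board_symmetry], free of square roots and of the real field. *)
Definition dist_preserving (s : {perm cell n.+1}) := forall a b,
  (sqnorm (pos (s a) - pos (s b)) = sqnorm (pos a - pos b))%R.

Lemma edge_imageE (s : {perm cell n.+1}) E a b :
  ([set s a; s b] \in edge_image s E) = ([set a; b] \in E).
Proof.
have I : injective (fun e : {set cell n.+1} => s @: e) by apply: imset_inj; exact: perm_inj.
have -> : [set s a; s b] = s @: [set a; b] by rewrite imsetU1 imset_set1.
exact: (mem_imset _ _ I).
Qed.

Lemma edge_imageM (s t : {perm cell n.+1}) E :
  edge_image s (edge_image t E) = edge_image (t * s)%g E.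
Proof.
rewrite /edge_image -imset_comp; apply: eq_imset => e /=.
by rewrite -imset_comp; apply: eq_imset => x /=; rewrite permM.
Qed.

Lemma edge_image1 E : edge_image 1%g E = E.
Proof.
rewrite /edge_image -[RHS]imset_id; apply: eq_imset => e /=.
by rewrite -[RHS]imset_id; apply: eq_imset => x; rewrite perm1.
Qed.

Lemma edge_imageK (s : {perm cell n.+1}) E : edge_image s^-1%g (edge_image s E) = E.
Proof. by rewrite edge_imageM mulgV edge_image1. Qed.

Lemma cycle_edges_map (s : {perm cell n.+1}) c : uniq c ->
  cycle_edges (map s c) = edge_image s (cycle_edges c).
Proof.
move=> Uc; have E x : s @: [set x; next c x] = [set s x; next (map s c) (s x)].
  by rewrite imsetU1 imset_set1 (next_map (@perm_inj _ s)).
apply/setP => e; apply/imsetP/imsetP.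
  case=> _ /mapP[x xc ->] ->; exists [set x; next c x]; last by rewrite E.
  by apply/imsetP; exists x.
by case=> _ /imsetP[x xc ->] ->; exists (s x); rewrite ?E // map_f.
Qed.

Lemma near_hamiltonian_image (s : {perm cell n.+1}) E : dist_preserving s ->
  near_hamiltonian_cycle E -> near_hamiltonian_cycle (edge_image s E).
Proof.
move=> ds [[c [/andP[Cc Uc] sc Ec]] H1]; split.
  exists (map s c); rewrite size_map cycle_edges_map // -Ec; split=> //.
  rewrite /ucycle (map_inj_uniq perm_inj) Uc andbT cycle_map.
  by rewrite -(eq_cycle (e := @grid_adj n.+1)) // => a b; rewrite /grid_adj /= ds.
have -> : cover (edge_image s E) = s @: cover E.
  apply/setP => x; apply/bigcupP/imsetP.
    by case=> _ /imsetP[e eE ->] /imsetP[y ye ->]; exists y => //; apply/bigcupP; exists e.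
  case=> y /bigcupP[e eE ye] ->; exists (s @: e); first by rewrite imset_f.
  by rewrite imset_f.
by move: H1 (cardsC (s @: cover E)) (cardsC (cover E)); rewrite (card_imset _ perm_inj); lia.
Qed.

(** By the parallelogram identity, [|x - y|^2 = 4 - |x + y|^2] for unit vectors. Going straight thus
    becomes a condition on distances, which symmetries preserve. *)
Lemma sqnorm_opp (x y : int * int) : sqnorm x = 1%R -> sqnorm y = 1%R ->
  (x == - y)%R = (sqnorm (x - y) == 4)%R.
Proof.
case: x y => [x1 x2] [y1 y2]; rewrite /sqnorm -pair_eqE /= => hx hy.
have ->: ((x1 - y1) ^+ 2 + (x2 - y2) ^+ 2 = 2 * (x1 ^+ 2 + x2 ^+ 2) +
    2 * (y1 ^+ 2 + y2 ^+ 2) - ((x1 + y1) ^+ 2 + (x2 + y2) ^+ 2))%R by ring.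
rewrite hx hy.
apply/andP/eqP => [[/eqP -> /eqP ->]|H]; first by lia.
have : ((x1 + y1) ^+ 2 + (x2 + y2) ^+ 2 == 0)%R by lia.
by rewrite paddr_eq0 ?sqr_ge0 // !sqrf_eq0; lia.
Qed.

Lemma turn_at_image (s : {perm cell n.+1}) E a : dist_preserving s -> grid E ->
  turn_at (edge_image s E) (s a) = turn_at E a.
Proof.
move=> ds gE.
have str u w : [set a; u] \in E -> [set a; w] \in E ->
    (pos (s u) - pos (s a) != - (pos (s w) - pos (s a)))%R = (pos u - pos a != - (pos w - pos a))%R.
  move=> uE wE; have g x : [set a; x] \in E -> sqnorm (pos x - pos a)%R = 1%R.
    by rewrite setUC => /gE /eqP.
  rewrite !sqnorm_opp ?ds ?g //.
  have e (p q r : int * int) : (p - r - (q - r) = p - q)%R by rewrite opprB addrA subrK.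
  by rewrite !e ds.
apply/existsP/existsP => -[u /existsP[w /and4P[uw uE wE t]]].
  have [u' eu] : exists u', u = s u' by exists (s^-1%g u); rewrite permKV.
  have [w' ew] : exists w', w = s w' by exists (s^-1%g w); rewrite permKV.
  subst u w; rewrite edge_imageE in uE; rewrite edge_imageE in wE.
  exists u'; apply/existsP; exists w'; rewrite uE wE -str // t (inj_eq perm_inj) in uw *.
  by rewrite uw.
exists (s u); apply/existsP; exists (s w).
by rewrite !edge_imageE uE wE str // t (inj_eq perm_inj) uw.
Qed.

Lemma near_min_image (s : {perm cell n.+1}) E : dist_preserving s ->
  near_min E -> near_min (edge_image s E).
Proof.
move=> ds [H T]; split; first exact: near_hamiltonian_image.
have gE : grid E by case: (H) => -[c /cycle_grid].
rewrite -T /turns.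
have -> : [set b | turn_at (edge_image s E) b] = s @: [set b | turn_at E b].
  apply/setP => x; rewrite -[x](permKV s) (mem_imset _ _ perm_inj) !inE turn_at_image //.
by rewrite card_imset //; exact: perm_inj.
Qed.

End Cells.

(** * The double spirals *)

Lemma vformE m d i j : vform m d i j =
  [|| (i <= m) && ~~ (i <= j <= m.*2 - i), (i == m.+1) && (j != m + d) |
      (m.+1 < i) && ~~ (m.*2 + 3 - i <= j < i)].
Proof. by rewrite /vform; case: (leqP i m) => im; [|case: eqP => e]; lia. Qed.

Definition link m d (p q : nat * nat) :=
  let: (i, j) := p in let: (i', j') := q in
  [&& i <= m.*2, j <= m.*2, i' <= m.*2, j' <= m.*2 &
  [|| [&& i == i', j.+1 == j' & hform m d i j'],
      [&& i == i', j'.+1 == j & hform m d i j],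
      [&& j == j', i.+1 == i' & vform m d i' j] |
      [&& j == j', i'.+1 == i & vform m d i j]]].

(** The edge between the two ends of a spiral, which is cut when the spiral is moved into the next
    larger board. *)
Definition closing m (p q : nat * nat) :=
  ((p == (m.*2, 0)) && (q == (m.*2, 1))) || ((p == (m.*2, 1)) && (q == (m.*2, 0))).

Arguments link : simpl never.
Arguments closing : simpl never.

Definition shift (p : nat * nat) := (p.1.+1, p.2.+1).

(** Inductive step for the spirals: apart from the closing edge, the formulas are compatible with
    enlarging the board by a new border. *)
Lemma link_shift m d p q : 0 < m -> d <= 1 -> link m d p q -> ~~ closing m p q ->
  link m.+1 d (shift p) (shift q).
Proof.
case: p q => [i j] [i' j'] m0 d1; rewrite /link /closing /shift /= !xpair_eqE.
case/and5P=> b1 b2 b3 b4 H C; apply/and5P; split; [lia..|].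
case/or4P: H => /and3P[/eqP e1 /eqP e2 H]; move: C; subst => C; apply/or4P.
- by constructor 1; rewrite !eqxx /=; move: H; rewrite /hform; lia.
- by constructor 2; rewrite !eqxx /=; move: H; rewrite /hform; lia.
- by constructor 3; rewrite !eqxx /=; move: H; rewrite !vformE; clear C; lia.
- by constructor 4; rewrite !eqxx /=; move: H; rewrite !vformE; clear C; lia.
Qed.

(* The border from (K, 2) round to (K, 0), which leaves out (K, 1). *)
Definition border K : seq (nat * nat) :=
  [seq (K, j) | j <- iota 2 K.-1] ++ [seq (i, K) | i <- rev (iota 0 K)] ++
  [seq (0, j) | j <- rev (iota 0 K)] ++ [seq (i, 0) | i <- iota 1 K].

Arguments border : simpl never.

(* A path from (2m, 1) to (2m, 0), m = p + 1, whose ends are adjacent. The edge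
   joining them is left out when the path is shifted into the larger board, where
   the new border closes the path up instead. *)
Fixpoint spiral d p : seq (nat * nat) :=
  if p is p'.+1 then
    (p.+1.*2, 1) :: rev (map shift (spiral d p')) ++ border p.+1.*2
  else (2, 1) :: (if d == 0 then [:: (2, 2); (1, 2)] else [:: (1, 1); (1, 2)]) ++
       [:: (0, 2); (0, 1); (0, 0); (1, 0); (2, 0)].

Lemma path_iota (T : Type) (e : rel T) (f : nat -> T) a l x :
  (forall i, a <= i < a + l -> e (f i) (f i.+1)) ->
  e x (f a) -> path e x (map f (iota a l.+1)).
Proof.
elim: l a x => [|l IH] a x H /= ->; first by [].
apply: IH; last by apply: H; lia.
by move=> i ai; apply: H; lia.
Qed.

Lemma path_rev_iota (T : Type) (e : rel T) (f : nat -> T) l x :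
  (forall i, i < l -> e (f i.+1) (f i)) ->
  e x (f l) -> path e x (map f (rev (iota 0 l.+1))).
Proof.
elim: l x => [|l IH] x H xl; first by rewrite /= xl.
rewrite -addn1 iotaD rev_cat /= add0n xl /=.
by apply: IH => [i il|]; [apply: H; lia | apply: H].
Qed.

Lemma last_iota (T : Type) (f : nat -> T) a l x : last x (map f (iota a l.+1)) = f (a + l).
Proof. by rewrite -addn1 iotaD map_cat last_cat. Qed.

Lemma last_rev_iota (T : Type) (f : nat -> T) l x : last x (map f (rev (iota 0 l.+1))) = f 0.
Proof. by rewrite /= rev_cons map_rcons last_rcons. Qed.

Lemma border_path (e : rel (nat * nat)) K x : 1 < K ->
  (forall j, 1 < j < K -> e (K, j) (K, j.+1)) -> (forall i, i < K -> e (i.+1, K) (i, K)) ->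
  (forall j, j < K -> e (0, j.+1) (0, j)) -> (forall i, i < K -> e (i, 0) (i.+1, 0)) ->
  e x (K, 2) -> path e x (border K).
Proof.
case: K => [|[|k]] // _ bottom right_ top left_ ex; rewrite /border !cat_path.
rewrite last_iota !last_rev_iota; apply/and4P; split.
- by apply: path_iota => // j jk; apply: bottom; lia.
- by apply: path_rev_iota => [i ik|]; apply: right_; lia.
- by apply: path_rev_iota => [i ik|]; apply: top; lia.
- by apply: (@path_iota _ _ (fun i => (i, 0))) => [i ik|]; apply: left_; lia.
Qed.

Lemma last_border K x : 0 < K -> last x (border K) = (K, 0).
Proof. by case: K => // k _; rewrite /border !last_cat last_iota add1n. Qed.

Lemma mem_mapl (a i j : nat) (s : seq nat) : ((i, j) \in [seq (a,
  x) | x <- s]) = (i == a) && (j \in s).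
Proof.
by apply/mapP/andP => [[x xs [-> ->]]|[/eqP -> js]]; [rewrite eqxx | exists j].
Qed.

Lemma mem_mapr (a i j : nat) (s : seq nat) : ((i, j) \in [seq (x,
  a) | x <- s]) = (j == a) && (i \in s).
Proof.
by apply/mapP/andP => [[x xs [-> ->]]|[/eqP -> js]]; [rewrite eqxx | exists i].
Qed.

Lemma mem_border K i j : 1 < K -> ((i, j) \in border K) =
  [&& i <= K, j <= K & [|| (i == K) && (j != 1), j == K, i == 0 | j == 0]].
Proof.
move=> K1; rewrite /border !mem_cat !mem_mapl !mem_mapr !mem_rev !mem_iota; lia.
Qed.

Lemma uniq_border K : 1 < K -> uniq (border K).
Proof.
move=> K1; rewrite /border !cat_uniq.
have i1 (a : nat) : injective (fun x : nat => (a, x)) by move=> x y [].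
have i2 (a : nat) : injective (fun x : nat => (x, a)) by move=> x y [].
rewrite !(map_inj_uniq (i1 _)) !(map_inj_uniq (i2 _)) !rev_uniq !iota_uniq /=.
rewrite !andbT; apply/andP; split; last (apply/andP; split=> //); apply/hasPn => -[i j];
  rewrite ?mem_cat /= ?mem_cat !mem_mapl !mem_mapr !mem_rev !mem_iota; lia.
Qed.

Lemma shift_inj : injective shift.
Proof. by move=> [i j] [i' j'] [-> ->]. Qed.

Lemma mem_shift i j s : ((i, j) \in map shift s) = [&& 0 < i, 0 < j & (i.-1, j.-1) \in s].
Proof.
case: i j => [|i] [|j] /=; try by apply/mapP => -[[a b] _ []].
exact: (mem_map shift_inj s (i, j)).
Qed.

Lemma mem_spiral d p i j : d <= 1 -> ((i, j) \in spiral d p) =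
  [&& i <= p.+1.*2, j <= p.+1.*2 & (i, j) != (p.+1 + d, p.+1 + d)].
Proof.
move=> d1; elim: p i j => [|p IH] i j.
  by case: d d1 => [|[]] // _; rewrite /= !inE !xpair_eqE; lia.
rewrite [spiral _ _]/= in_cons mem_cat mem_rev mem_shift IH mem_border //.
rewrite !xpair_eqE; lia.
Qed.

Lemma uniq_spiral d p : d <= 1 -> uniq (spiral d p).
Proof.
move=> d1; elim: p => [|p IH]; first by case: d d1 => [|[]].
rewrite [spiral _ _]/= cons_uniq cat_uniq rev_uniq (map_inj_uniq shift_inj) IH uniq_border //
  andTb andbT.
rewrite mem_cat mem_rev mem_shift mem_border // mem_spiral //; apply/andP; split; first lia.
apply/hasPn => -[i j]; rewrite mem_border // /= mem_rev mem_shift mem_spiral // xpair_eqE; lia.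
Qed.

Definition step m d := [rel p q | link m d p q && ~~ closing m p q].

Lemma link_sym m d p q : link m d p q = link m d q p.
Proof.
suff sym x y : link m d x y -> link m d y x by apply/idP/idP; apply: sym.
case: x y => [i j] [i' j'] /and5P[b1 b2 b3 b4 /or4P[] /and3P[/eqP ij e H]]; apply/and5P;
  split=> //; apply/or4P; [constructor 2|constructor 1|constructor 4|constructor 3];
  by rewrite ij eqxx e -?ij ?H // ij H.
Qed.

Lemma closing_sym m p q : closing m p q = closing m q p.
Proof. by rewrite /closing orbC andbC [X in _ || X]andbC. Qed.

Lemma spiral_path d p : d <= 1 -> exists t, [/\ spiral d p = (p.+1.*2, 1) :: t,
  last (p.+1.*2, 1) t = (p.+1.*2, 0) & path (step p.+1 d) (p.+1.*2, 1) t].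
Proof.
move=> d1; elim: p => [|p [t [Es Lt Pt]]].
  by case: d d1 => [|[]] // _; (eexists; split; [by [] | by [] | by []]).
set e := step p.+2 d; pose K := p.+2.*2.
(* Reversed, the shifted spiral begins above [(K, 1)], at [(K.-1, 1)], and ends above the first
   border cell [(K, 2)], at [(K.-1, 2)]. *)
exists (rev (map shift (spiral d p)) ++ border K); split=> //.
  by rewrite last_cat last_border.
rewrite cat_path Es map_cons rev_cons last_rcons.
apply/andP; split.
  have P' : path e (shift (p.+1.*2, 1)) (map shift t).
    apply: homo_path Pt => x y /andP[l c]; rewrite /e /= link_shift //=.
    by case: x y {l c} => [? ?] [? ?]; rewrite /closing /shift !xpair_eqE; lia.
  rewrite -rev_cons lastI rev_rcons /= last_map Lt; apply/andP; split.
    by rewrite /e /= /link /closing /shift /= !xpair_eqE !vformE; lia.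
  have := rev_path e (shift (p.+1.*2, 1)) (map shift t); rewrite last_map Lt => ->.
  rewrite -(eq_path (e := e)) // => x y; by rewrite /e /= link_sym closing_sym.
apply: border_path; rewrite /K /e //.
- by move=> j jK; rewrite /= /link /closing ?xpair_eqE /hform; lia.
- by move=> i iK; rewrite /= /link /closing ?xpair_eqE !vformE; lia.
- by move=> i iK; rewrite /= /link /closing ?xpair_eqE /hform; lia.
- by move=> i iK; rewrite /= /link /closing ?xpair_eqE !vformE; lia.
- by rewrite /= /link /closing /shift /= ?xpair_eqE !vformE; lia.
Qed.

Section Spiral.

Variables (p d : nat).
Hypothesis d1 : d <= 1.
Let m := p.+1.
Let n := m.*2.

Definition spiral_cells : seq (cell n.+1) := [seq cl n q.1 q.2 | q <- spiral d p].
Definition spiral_edges : edge_set n.+1 := cycle_edges spiral_cells.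

Lemma cl_inj_in (s : seq (nat * nat)) : (forall q, q \in s -> q.1 <= n /\ q.2 <= n) ->
  {in s &, injective (fun q => cl n q.1 q.2)}.
Proof.
move=> H [i j] [i' j'] /H[/= iN jN] /H[/= iN' jN'] /eqP.
by rewrite cl_eq // => /andP[/eqP -> /eqP ->].
Qed.

Lemma spiral_bound q : q \in spiral d p -> q.1 <= n /\ q.2 <= n.
Proof. by case: q => i j; rewrite mem_spiral // => /and3P[]. Qed.

Lemma mem_spiral_cells a : (a \in spiral_cells) = ((a.1 : nat, a.2 : nat) != (m + d, m + d)).
Proof.
apply/mapP/idP => [[[i j] ij ->]|ne].
  have [iN jN] := spiral_bound ij; move: ij; rewrite mem_spiral // cl1 ?cl2 //.
  by case/and3P.
by exists (a.1 : nat, a.2 : nat); rewrite ?clK // mem_spiral // ne !leq_ord.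
Qed.

Lemma uniq_spiral_cells : uniq spiral_cells.
Proof. by rewrite map_inj_in_uniq ?uniq_spiral //; apply: cl_inj_in => q; exact: spiral_bound. Qed.

Definition linkc (a b : cell n.+1) := link m d (a.1 : nat, a.2 : nat) (b.1 : nat, b.2 : nat).

Lemma spiral_cycle : path.cycle linkc spiral_cells.
Proof.
rewrite /spiral_cells; have [t [Es Lt Pt]] := spiral_path p d1.
have E : {in [in spiral d p] &, relpre (fun q => cl n q.1 q.2) linkc =2 link m d}.
  move=> x y /spiral_bound[x1 x2] /spiral_bound[y1 y2].
  by rewrite /= /linkc !cl1 // ?cl2 //; case: x y {x1 x2 y1 y2} => [? ?] [].
rewrite cycle_map (eq_in_cycle E (allss _)) Es /= rcons_path Lt (sub_path _ Pt) /=.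
  by rewrite /link /hform /m; lia.
by move=> x y /andP[].
Qed.

Lemma linkc_grid : subrel linkc (@grid_adj n.+1).
Proof.
move=> a b; rewrite /linkc grid_adjE => /and5P[_ _ _ _ /or4P[] /and3P[e1 e2 _]];
  by move: e1 e2; clear; lia.
Qed.

Lemma spiral_cycle_on : cycle_on spiral_edges spiral_cells.
Proof.
split=> //; first by rewrite /ucycle uniq_spiral_cells (sub_cycle linkc_grid spiral_cycle).
rewrite size_map; case: (p) => [|p']; first by case: (d) => [|[]].
by rewrite [spiral _ _]/= /= size_cat /border !size_cat !size_map size_iota; lia.
Qed.

Lemma near_hamiltonian_spiral : near_hamiltonian_cycle spiral_edges.
Proof.
split; first by exists spiral_cells; case: spiral_cycle_on.
have md : m + d < n.+1 by rewrite /n /m; lia.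
apply/eqP/cards1P; exists (cl n (m + d) (m + d)); apply/setP => a.
rewrite !inE (cycle_cover spiral_cycle_on) mem_spiral_cells negbK cell_eqE.
by rewrite cl1 // ?cl2 // xpair_eqE.
Qed.

End Spiral.

(** * Edges and turns of the spirals *)

(** The edges of a spiral satisfy the formulas and its degrees already attain this bound, so
    [spiral_form] can conclude that the formulas allow no other edge. The guards discard values off
    the board, such as [vform m d m.*2.+1 0], which is true. *)
Lemma form_deg m d i j : 1 < m -> d <= 1 -> i <= m.*2 -> j <= m.*2 ->
  ((0 < j) && hform m d i j) + ((j < m.*2) && hform m d i j.+1) +
  ((0 < i) && vform m d i j) + ((i < m.*2) && vform m d i.+1 j) <=
  (~~ ((i == m + d) && (j == m + d))).*2.
Proof.
move=> m1 d1 iN jN.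
case: (ltngtP i m) => im.
- have Hh x : hform m d i x = (i < x <= m.*2 - i) by rewrite /hform; lia.
  have Hv : vform m d i j = ~~ (i <= j <= m.*2 - i) by rewrite vformE; lia.
  have Hv' : vform m d i.+1 j = ~~ (i.+1 <= j <= m.*2 - i.+1) by rewrite vformE; lia.
  rewrite !Hh Hv Hv'; lia.
- case: (eqVneq i m.+1) => [->|im1].
    have Hh x : hform m d m.+1 x = (d == 0) && (x == m.+1) by rewrite /hform; lia.
    have Hv : vform m d m.+1 j = (j != m + d) by rewrite vformE; lia.
    have Hv' : vform m d m.+2 j = (j != m.+1) by rewrite vformE; lia.
    by rewrite !Hh Hv Hv'; case: d d1 {Hh Hv Hv'} => [|[]] // _; rewrite ?addn0 ?addn1; lia.
  have Hh x : hform m d i x = (m.*2 - i + 2 < x <= i) || (i == m.*2) && (x == 1)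
    by rewrite /hform; lia.
  have Hv : vform m d i j = ~~ (m.*2 + 3 - i <= j < i) by rewrite vformE; lia.
  have Hv' : vform m d i.+1 j = ~~ (m.*2 + 2 - i <= j < i.+1) by rewrite vformE; lia.
  rewrite !Hh Hv Hv'; have -> : (i == m + d) = false by lia.
  case: (eqVneq i m.*2) => [->|ne] /=.
    by rewrite ltnn subnn /=; lia.
  by rewrite !orbF; lia.
- subst i.
  have Hh x : hform m d m x = (d == 1) && (x == m.+1) by rewrite /hform; lia.
  have Hv : vform m d m j = (j != m) by rewrite vformE; lia.
  have Hv' : vform m d m.+1 j = (j != m + d) by rewrite vformE; lia.
  by rewrite !Hh Hv Hv'; case: d d1 {Hh Hv Hv'} => [|[]] // _; rewrite ?addn0 ?addn1; lia.
Qed.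

Lemma changes_interval a b n : a < b <= n -> changes (fun i => a < i <= b) n.+1 = 2.
Proof.
move=> abn.
have an : a < n.+1 by lia. have bn : b < n.+1 by lia.
rewrite /changes (bigD1 (Ordinal an)) //= (bigD1 (Ordinal bn)) /=; last by rewrite -val_eqE /=; lia.
rewrite big1 => [|i]; last by rewrite -!val_eqE /=; lia.
lia.
Qed.

Lemma eq_changes (f g : nat -> bool) n : (forall i, i <= n -> f i = g i) ->
  changes f n = changes g n.
Proof. by move=> fg; apply: eq_bigr => i _; rewrite !fg //; case: i => i /= /ltnW. Qed.

Section SpiralForm.

Variables (p d : nat).
Hypothesis d1 : d <= 1.
Hypothesis p0 : 0 < p.
Let m := p.+1.
Let n := m.*2.
Let E := spiral_edges p d.
Let C := spiral_cycle_on p d1.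

Lemma spiral_link a b : [set a; b] \in E -> linkc d a b.
Proof.
case/imsetP => x xs /eq_set2[[-> ->]|[-> ->]]; have l := next_cycle (spiral_cycle p d1) xs => //.
by rewrite /linkc link_sym.
Qed.

Lemma spiral_hE i j : hE E i j -> (0 < j) && hform m d i j.
Proof.
case/and4P=> iN j0 jN /spiral_link /and5P[_ _ _ _]; rewrite !cl1 ?cl2 //;
  last exact: leq_trans (leq_pred _) jN.
rewrite prednK // !eqxx j0 /=; case/or4P; rewrite ?eqxx //=; first by case/andP=> /eqP; lia.
  by case/and3P=> /eqP; lia.
by case/and3P=> /eqP; lia.
Qed.

Lemma spiral_vE i j : vE E i j -> (0 < i) && vform m d i j.
Proof.
case/and4P=> i0 iN jN /spiral_link /and5P[_ _ _ _]; rewrite !cl1 ?cl2 //;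
  last exact: leq_trans (leq_pred _) iN.
rewrite prednK // !eqxx i0 /=; case/or4P; rewrite ?eqxx //=.
- by case/and3P=> /eqP; lia.
- by case/and3P=> /eqP; lia.
- by case/andP=> /eqP; lia.
Qed.

Lemma spiral_form i j : i <= n -> j <= n -> hE E i j = hform m d i j /\ vE E i j = vform m d i j.
Proof.
move=> iN jN.
have leq_b2n (a b : bool) : (a -> b) -> a <= b by case: a b => [] [] // /(_ isT).
have hh : hE E i j <= (0 < j) && hform m d i j by apply: leq_b2n; exact: spiral_hE.
have vv : vE E i j <= (0 < i) && vform m d i j by apply: leq_b2n; exact: spiral_vE.
have hh' : hE E i j.+1 <= (j < n) && hform m d i j.+1.
  by apply: leq_b2n => /[dup] /spiral_hE /andP[_ ->] /and4P[_ _ ->].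
have vv' : vE E i.+1 j <= (i < n) && vform m d i.+1 j.
  by apply: leq_b2n => /[dup] /spiral_vE /andP[_ ->] /and4P[_ ->].
have deg : (~~ ((i == m + d) && (j == m + d))).*2 = hE E i j + hE E i j.+1 + vE E i j + vE E i.+1 j.
  rewrite -card_nbr //; last exact: cycle_grid C.
  have := @mem_spiral_cells p d d1 (cl n i j); rewrite cl1 // ?cl2 // xpair_eqE => ms.
  case: (boolP (_ && _)) ms => _ ms.
    by rewrite eq_card0 // => x; rewrite inE no_nbr // (cycle_cover C) ms.
  by rewrite (card_cycle_nbr C).
have := form_deg (p0 : 1 < m) d1 iN jN; rewrite deg => le.
(* Termwise inequalities together with the reverse inequality between the sums force equality in
   each term. *)
have sq (a b x y a' b' x' y' : nat) : a <= a' -> b <= b' -> x <= x' -> y <= y' ->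
  a' + b' + x' + y' <= a + b + x + y -> a = a' /\ x = x' by clear; lia.
have b_inj (a b : bool) : a = b :> nat -> a = b by case: a b => [] [].
have [/b_inj e1 /b_inj e2] := sq _ _ _ _ _ _ _ _ hh hh' vv vv' le.
rewrite e1 e2; split.
  by case: j {hh hh' vv vv' le deg e1 e2 jN} => //; rewrite /hform; lia.
by case: i iN {hh hh' vv vv' le deg e1 e2} => // _; rewrite vformE; lia.
Qed.

Lemma spiral_col j : j <= n -> row_turns (transp (vE E)) n j = 2.
Proof.
move=> jN.
have top : vE E n.+1 j = false by rewrite /vE ltnn andbF.
suff [t [b [tb Etb]]] : exists t b, t < b <= n /\ forall i, i <= n -> vform m d i j = (t < i <= b).
  rewrite -(changes_interval tb); apply: eq_changes => i; rewrite leq_eqVlt => /orP[/eqP ->|iN].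
    by rewrite /transp top; lia.
  by rewrite -Etb // /transp; have [_ ->] := spiral_form iN jN.
have m1 : 1 < m by [].
rewrite /n in jN *; move: (m) jN m1 => k jN m1.
(* The segment in the column of the missing cell is a single edge, below that cell for [d = 0] and
   above it for [d = 1]. *)
case: (eqVneq j (k + d)) => [->|jk].
  case: d d1 => [|[]] // _.
    exists k.+1, k.+2; split; first lia.
    by move=> i iN; rewrite vformE; lia.
  exists k.-1, k; split; first lia.
  by move=> i iN; rewrite vformE; lia.
(* The arcs are nested symmetrically in the upper half, while those of the lower half start two
   columns further right. Truncation of [j - 2] makes columns [0], [1] and [2] all reach the last
   row. *)
exists (minn j (k.*2 - j)), (k.*2 - minn (j - 2) (k.*2 - j)); split; first lia.
move=> i iN; rewrite vformE (_ : j != k + d = true) //; clear jk; lia.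
Qed.

Lemma near_min_spiral : near_min E.
Proof.
split; first exact: near_hamiltonian_spiral.
have [r [c B]] := board_of_cycle (near_hamiltonian_spiral p d1).
rewrite (turns_rows B (cycle_grid C)) (sum_turns B).
rewrite (eq_bigr (fun=> 2)) => [|j _]; last exact/spiral_col/leq_ord.
by rewrite sum_nat_const card_ord mulnC.
Qed.

End SpiralForm.

(** * Symmetries *)

Section Symmetries.

Variable n : nat.
Implicit Types (a b : cell n.+1) (s : {perm cell n.+1}) (q : bool * bool * bool) (E : edge_set
  n.+1).

(** A normal form for the dihedral group of order 8: the flags stand for a transposition, applied
    first, and the reversals of the two coordinates. *)
Definition sym_fun q a : cell n.+1 :=
  let a' := if q.1.1 then (a.2, a.1) else a in
  (if q.1.2 then rev_ord a'.1 else a'.1, if q.2 then rev_ord a'.2 else a'.2).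

Lemma sym_fun_inj q : injective (sym_fun q).
Proof.
case: q => [[t f] g] [a1 a2] [b1 b2].
case: t f g => [] [] [] E; have := congr1 fst E; have := congr1 snd E => /= e1 e2; congr pair;
  first [exact: e1 | exact: e2 | exact: rev_ord_inj e1 | exact: rev_ord_inj e2].
Qed.

Definition sym q : {perm cell n.+1} := perm (@sym_fun_inj q).

Lemma symE q a : sym q a = sym_fun q a.
Proof. exact: permE. Qed.

(** The same symmetry in coordinates over any ring: over [int] it acts on positions of cells, over
    [R] it is the isometry required by [board_symmetry]. *)
Definition pos_sym (A : pzRingType) (K : A) q (x : A * A) : A * A :=
  let x' := if q.1.1 then (x.2, x.1) else x in
  (if q.1.2 then (K - x'.1)%R else x'.1, if q.2 then (K - x'.2)%R else x'.2).

Lemma rev_ordZ (i : 'I_n.+1) : ((rev_ord i : nat)%:Z = n%:Z - (i : nat)%:Z)%R.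
Proof. by rewrite /= subSS -subzn // leq_ord. Qed.

Lemma pos_symE q a : pos (sym q a) = pos_sym n%:Z q (pos a).
Proof. by rewrite symE; case: q a => [[[] []] []] [a1 a2]; rewrite /pos /pos_sym /= ?rev_ordZ. Qed.

Lemma pos_sym_dist (A : comNzRingType) (K : A) q (x y : A * A) :
  (sqnorm (pos_sym K q x - pos_sym K q y) = sqnorm (x - y))%R.
Proof. by case: q x y => [[[] []] []] [x1 x2] [y1 y2]; rewrite /sqnorm /=; ring. Qed.

Lemma sym_dist q : dist_preserving (sym q).
Proof. by move=> a b; rewrite !pos_symE pos_sym_dist. Qed.

Lemma dist_preservingM s t : dist_preserving s -> dist_preserving t -> dist_preserving (s * t)%g.
Proof. by move=> ds dt a b; rewrite !permM dt ds. Qed.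

Lemma dist_preservingV s : dist_preserving s -> dist_preserving s^-1%g.
Proof. by move=> ds a b; rewrite -ds !permKV. Qed.

Lemma sqnorm_ge0 (A : realDomainType) (x : A * A) : (0 <= sqnorm x)%R.
Proof. by rewrite addr_ge0 ?sqr_ge0. Qed.

Lemma dist_int (R : realType) a b :
  dist (plane_pos R a) (plane_pos R b) = Num.sqrt ((sqnorm (pos a - pos b)%R)%:~R)%R.
Proof. by rewrite /dist /plane_pos /sqnorm /= -!rmorphB -!rmorphXn -rmorphD. Qed.

Lemma board_symmetry_dist (R : realType) s : board_symmetry R s -> dist_preserving s.
Proof.
case=> f fi fs a b; have := fi (plane_pos R a) (plane_pos R b).
rewrite !fs !dist_int => /eqP; rewrite eqr_sqrt ?ler0z ?sqnorm_ge0 //.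
by rewrite eqr_int => /eqP.
Qed.

Lemma sym_board_symmetry (R : realType) q : board_symmetry R (sym q).
Proof.
exists (pos_sym (n%:R)%R q) => [x y|a]; first by rewrite /dist pos_sym_dist.
rewrite {2}/plane_pos pos_symE /plane_pos; case: q => [[[] []] []]; by rewrite /pos_sym /= ?rmorphB.
Qed.

Lemma pos_cl i j : i <= n -> j <= n -> pos (cl n i j) = (i%:Z, j%:Z)%R.
Proof. by move=> iN jN; rewrite /pos cl1 // ?cl2. Qed.

Lemma sym_cl q i j : i <= n -> j <= n -> sym q (cl n i j) =
  let x := if q.1.1 then (j, i) else (i, j) in
  cl n (if q.1.2 then n - x.1 else x.1) (if q.2 then n - x.2 else x.2).
Proof.
move=> iN jN; apply/eqP; rewrite symE cell_eqE.
by case: q => [[[] []] []] /=; rewrite !inordK ?ltnS ?leq_subr // ?subSS !eqxx.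
Qed.

Hypothesis n0 : 0 < n.

(** Distances to three corners determine a cell: the difference of the squared distances to two
    adjacent corners is linear in one coordinate. *)
Lemma dist_preserving_fix s : dist_preserving s ->
  s (cl n 0 0) = cl n 0 0 -> s (cl n 0 n) = cl n 0 n -> s (cl n n n) = cl n n n -> s = 1%g.
Proof.
move=> ds f1 f2 f3; apply/permP => a; rewrite perm1.
have := ds a (cl n 0 0); have := ds a (cl n 0 n); have := ds a (cl n n n).
rewrite f1 f2 f3 !pos_cl // /sqnorm /= => h1 h2 h3; apply/eqP; rewrite cell_eqE.
move: h1 h2 h3 n0; clear.
move: (nat_of_ord a.1) (nat_of_ord a.2) (nat_of_ord (s a).1) (nat_of_ord (s a).2) => x y x' y'
  h1 h2 h3 n0.
have /eqP : (n%:Z * (y'%:Z - y%:Z) = 0)%R by clear h1; lia.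
have /eqP : (n%:Z * (x'%:Z - x%:Z) = 0)%R by clear h3; lia.
by rewrite !mulf_eq0; clear h1 h2 h3; lia.
Qed.

Lemma corner_coord (x y : nat) : x <= n -> y <= n -> ((x%:Z - y%:Z) ^+ 2 <= n%:Z ^+ 2)%R /\
  ((x%:Z - y%:Z) ^+ 2 = n%:Z ^+ 2 -> x = 0 /\ y = n \/ x = n /\ y = 0)%R.
Proof.
move=> xn yn; split; first by nia.
by move/eqP; rewrite eqf_sqr; lia.
Qed.

Lemma opposite_corners (x1 y1 x2 y2 : nat) : x1 <= n -> y1 <= n -> x2 <= n -> y2 <= n ->
  ((x1%:Z - x2%:Z) ^+ 2 + (y1%:Z - y2%:Z) ^+ 2 = n%:Z ^+ 2 + n%:Z ^+ 2)%R ->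
  (x1 = 0 /\ x2 = n \/ x1 = n /\ x2 = 0) /\ (y1 = 0 /\ y2 = n \/ y1 = n /\ y2 = 0).
Proof.
move=> b1 b2 b3 b4 e.
have [l1 h1] := corner_coord b1 b3; have [l2 h2] := corner_coord b2 b4.
by split; [apply: h1 | apply: h2]; move: e l1 l2; clear; lia.
Qed.

(** Subtracting the equations gives [x + y = n]; then the first one gives [x * y = 0]. *)
Lemma third_corner (x y : nat) : x <= n -> y <= n ->
  (x%:Z ^+ 2 + y%:Z ^+ 2 = n%:Z ^+ 2)%R -> ((n%:Z - x%:Z) ^+ 2 + (n%:Z - y%:Z) ^+ 2 = n%:Z ^+
    2)%R ->
  x = 0 /\ y = n \/ x = n /\ y = 0.
Proof.
move=> xn yn e1 e2.
have /eqP : (n%:Z * (x%:Z + y%:Z - n%:Z) = 0)%R by lia.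
rewrite mulf_eq0 => /orP[/eqP|/eqP] e; first lia.
have /eqP : (x%:Z * y%:Z = 0)%R.
  have ey : (y%:Z = n%:Z - x%:Z)%R by lia.
  by rewrite ey in e1 *; clear e2 ey; lia.
by rewrite mulf_eq0; lia.
Qed.

(** A diagonal has the greatest possible length, so it goes to a diagonal. The image of [(0, 0)]
    fixes the two reversals; that of [(0, n)], at distance [n] from both ends of the diagonal, fixes
    the transposition. *)
Lemma dist_preserving_sym s : dist_preserving s -> exists q, s = sym q.
Proof.
move=> ds.
suff [q [e1 e2 e3]] : exists q, [/\ s (cl n 0 0) = sym q (cl n 0 0),
  s (cl n 0 n) = sym q (cl n 0 n) &
     s (cl n n n) = sym q (cl n n n)].
  exists q; have : (s * (sym q)^-1 = 1)%g.
    apply: dist_preserving_fix; rewrite ?permM ?e1 ?e2 ?e3 ?permK //.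
    exact: dist_preservingM ds (dist_preservingV (sym_dist q)).
  by move/(canRL (mulgKV _)); rewrite mul1g.
have := ds (cl n 0 0) (cl n n n); have := ds (cl n 0 n) (cl n 0 0);
  have := ds (cl n 0 n) (cl n n n).
rewrite -(clK (s (cl n 0 0))) -(clK (s (cl n 0 n))) -(clK (s (cl n n n))).
move: (leq_ord (s (cl n 0 0)).1) (leq_ord (s (cl n 0 0)).2) (leq_ord (s (cl n 0 n)).1)
  (leq_ord (s (cl n 0 n)).2) (leq_ord (s (cl n n n)).1) (leq_ord (s (cl n n n)).2).
move: (nat_of_ord (s (cl n 0 0)).1) (nat_of_ord (s (cl n 0 0)).2)
  (nat_of_ord (s (cl n 0 n)).1) (nat_of_ord (s (cl n 0 n)).2)
  (nat_of_ord (s (cl n n n)).1) (nat_of_ord (s (cl n n n)).2)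
  => x1 y1 x2 y2 x3 y3 b1 b2 b3 b4 b5 b6.
rewrite !pos_cl // /sqnorm /= => h23 h21 h13.
have [Hx Hy] : (x1 = 0 /\ x3 = n \/ x1 = n /\ x3 = 0) /\ (y1 = 0 /\ y3 = n \/ y1 = n /\ y3 = 0).
  by apply: opposite_corners => //; rewrite h13; ring.
have [f [ex1 ex3]] : exists f : bool, x1 = (if f then n else 0) /\ x3 = (if f then 0 else n).
  by case: Hx => -[-> ->]; [exists false | exists true].
have [g [ey1 ey3]] : exists g : bool, y1 = (if g then n else 0) /\ y3 = (if g then 0 else n).
  by case: Hy => -[-> ->]; [exists false | exists true].
have := @third_corner (if f then n - x2 else x2) (if g then n - y2 else y2).
rewrite {Hx Hy h13 b1 b2 b5 b6}ex1 {}ex3 {}ey1 {}ey3 in h23 h21 *.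
move=> T; have {T} : (if f then n - x2 else x2) = 0 /\ (if g then n - y2 else y2) = n \/
    (if f then n - x2 else x2) = n /\ (if g then n - y2 else y2) = 0.
  apply: T.
  - by case: (f); rewrite ?leq_subr.
  - by case: (g); rewrite ?leq_subr.
  - have -> : (n%:Z ^+ 2 = (0%:Z - 0%:Z) ^+ 2 + (n%:Z - 0%:Z) ^+ 2)%R by ring.
    by rewrite -h21; case: (f); case: (g); rewrite -?subzn //; ring.
  - have -> : (n%:Z ^+ 2 = (0%:Z - n%:Z) ^+ 2 + (n%:Z - n%:Z) ^+ 2)%R by ring.
    by rewrite -h23; case: (f); case: (g); rewrite -?subzn //; ring.
move=> H; move: b3 b4 H; clear => b3 b4 [] [hx hy]; [exists (false, f, g) | exists (true, f, g)];
  rewrite !sym_cl //=; split; congr cl; move: hx hy; case: (f); case: (g); lia.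
Qed.

(** * Normalizing a minimal cycle by symmetries *)

Lemma edge_image_transp_h E i j : hE (edge_image (sym (true, false,
  false)) E) i j = transp (vE E) i j.
Proof.
rewrite /hE /transp /vE andbCA; case: (posnP j) => //= j0; case: (leqP i n) => //= iN;
  case: (leqP j n) => //= jN.
have Es x y : x <= n -> y <= n -> cl n x y = sym (true, false, false) (cl n y x) by move=> *;
  rewrite sym_cl.
by rewrite (Es i j.-1) ?(Es i j) ?(leq_trans (leq_pred _)) // edge_imageE.
Qed.

Lemma edge_image_transp_v E i j : vE (edge_image (sym (true, false,
  false)) E) i j = transp (hE E) i j.
Proof.
rewrite /vE /transp /hE; case: (leqP j n) => jN; last by rewrite !andbF.
case: (posnP i) => //= i0; case: (leqP i n) => //= iN.
have Es x y : x <= n -> y <= n -> cl n x y = sym (true, false, false) (cl n y x) by move=> *;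
  rewrite sym_cl.
by rewrite (Es i.-1 j) ?(Es i j) ?(leq_trans (leq_pred _)) // edge_imageE.
Qed.

Lemma edge_image_flip_h E i j : hE (edge_image (sym (false, true,
  false)) E) i j = flip_h n (hE E) i j.
Proof.
rewrite /hE /flip_h leq_subr; case: (posnP j) => //= j0.
case: (leqP i n) => //= iN; case: (leqP j n) => //= jN.
have Es x y : x <= n -> y <= n -> cl n x y = sym (false, true, false) (cl n (n - x) y).
  by move=> *; rewrite sym_cl ?leq_subr //= subKn.
by rewrite (Es i j.-1) ?(Es i j) ?(leq_trans (leq_pred _)) // edge_imageE.
Qed.

Lemma edge_image_flip_v E i j : vE (edge_image (sym (false, true,
  false)) E) i j = flip_v n (vE E) i j.
Proof.
rewrite /vE /flip_v.
case: (leqP j n) => jN; last by rewrite !andbF.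
rewrite [LHS]andbA [RHS]andbA.
have -> : (0 < n.+1 - i) && (n.+1 - i <= n) = (0 < i) && (i <= n) by lia.
case: (posnP i) => //= i0; case: (leqP i n) => //= iN.
have Es x y : x <= n -> y <= n -> cl n x y = sym (false, true, false) (cl n (n - x) y).
  by move=> *; rewrite sym_cl ?leq_subr //= subKn.
rewrite (Es i.-1 j) ?(Es i j) ?(leq_trans (leq_pred _)) // edge_imageE setUC.
by congr ([set cl _ _ _; cl _ _ _] \in E); lia.
Qed.

Lemma near_min_board E : near_min E ->
  exists r c, [/\ board n (hE E) (vE E) r c, grid E &
                  \sum_(i < n.+1) row_turns (hE E) n i = n.+1.*2].
Proof.
case=> [[[s C] H1] T].
have gE := cycle_grid (C : cycle_on E s).
have [r [c B]] := board_of_cycle (conj (ex_intro _ s C) H1).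
by exists r, c; split=> //; rewrite -(turns_rows B gE) T mul2n.
Qed.

Hypothesis n_ge4 : 4 <= n.
Hypothesis n_odd : odd n.+1.

(** If all rows and columns had turns, the total would leave exactly two to each, contrary to
    [not_two_turns]. A column without turns is made a row by transposition. *)
Lemma exists_row0 E : near_min E -> exists s, [/\ dist_preserving s, near_min (edge_image s E) &
  exists i, i <= n /\ row_turns (hE (edge_image s E)) n i = 0].
Proof.
move=> NE; have [r [c [B gE T]]] := near_min_board NE.
case: (boolP [exists i : 'I_n.+1, row_turns (hE E) n i == 0]) => [/existsP[i /eqP i0]|].
  exists 1%g; rewrite edge_image1; split=> //; first by move=> a b; rewrite !perm1.
  by exists i; rewrite leq_ord.
rewrite negb_exists => /forallP rows.
case: (boolP [exists j : 'I_n.+1, row_turns (transp (vE E)) n j == 0]) => [/existsP[j /eqP j0]|].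
  exists (sym (true, false, false)).
  have NE' : near_min (edge_image (sym (true, false, false)) E)
    by apply: near_min_image (sym_dist _) NE.
  split=> //; first exact: sym_dist.
  exists j; split; first exact: leq_ord.
  by rewrite -[RHS]j0; apply: eq_changes => i _; rewrite edge_image_transp_h.
rewrite negb_exists => /forallP cols.
case: (not_two_turns n_ge4 B) => i iN; split; move: i iN; apply: (sum_slack0 (N := n.+1)) => //.
- by move=> i iN; apply: (row_turns_ge2 B (rows (Ordinal iN))).
- by move=> i iN; apply: (row_turns_ge2 (board_transp B) (cols (Ordinal iN))).
- by rewrite -(sum_turns B).
Qed.

(** By [not_both_sides] one of the outer rows does not have two turns; a flip makes it the last
    one. *)
Lemma exists_row0_last E i0 : near_min E -> i0 <= n -> row_turns (hE E) n i0 = 0 ->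
  exists s, [/\ dist_preserving s, near_min (edge_image s E),
    row_turns (hE (edge_image s E)) n n != 2 &
    exists i, i <= n /\ row_turns (hE (edge_image s E)) n i = 0].
Proof.
move=> NE iN Ti; have [r [c [B gE T]]] := near_min_board NE.
have [ir _ _] := row_turns0 B n_ge4 n_odd iN Ti; rewrite ir in Ti.
case: (eqVneq (row_turns (hE E) n n) 2) => [Tn|Tn]; last first.
  exists 1%g; rewrite edge_image1; split=> //; first by move=> a b; rewrite !perm1.
  by exists r; rewrite (board_r B).
have T0 : row_turns (hE E) n 0 != 2.
  by apply/eqP => T0; apply: (not_both_sides B n_ge4 n_odd Ti T).
have Er i : i <= n -> row_turns (hE (edge_image (sym (false, true,
  false)) E)) n i = row_turns (hE E) n (n - i).
  by move=> iN'; rewrite -row_turns_flip //; apply: eq_changes => j _; rewrite edge_image_flip_h.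
exists (sym (false, true, false)); split; first exact: sym_dist.
- exact: near_min_image (sym_dist _) NE.
- by rewrite Er // subnn.
- by exists (n - r); rewrite leq_subr Er ?leq_subr // subKn // (board_r B).
Qed.

(** The left-right reflection, written as a flip conjugated by the transposition so that the lemmas
    on these two apply. *)
Definition mirror E := edge_image (sym (true, false, false)) (edge_image (sym (false, true, false))
  (edge_image (sym (true, false, false)) E)).

Lemma mirror_h E i j : i <= n -> hE (mirror E) i j = hE E i (n.+1 - j).
Proof. by move=> iN; rewrite edge_image_transp_h /transp edge_image_flip_v /flip_v
  edge_image_transp_v. Qed.

Lemma mirror_rows E i : i <= n -> row_turns (hE (mirror E)) n i = row_turns (hE E) n i.
Proof.
move=> iN; rewrite -(@col_turns_flip n (transp (hE E)) i); apply: eq_changes => j _.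
by rewrite mirror_h.
Qed.

Lemma normalize E : near_min E -> exists s, [/\ dist_preserving s, near_min (edge_image s E) &
  exists m d, [/\ n = m.*2, d <= 1 & forall i j, i <= n -> j <= n ->
    hE (edge_image s E) i j = hform m d i j /\ vE (edge_image s E) i j = vform m d i j]].
Proof.
move=> NE; have [s1 [ds1 N1 [i1 [iN1 T1]]]] := exists_row0 NE.
have [s2 [ds2]] := exists_row0_last N1 iN1 T1.
rewrite edge_imageM; set s := (s1 * s2)%g; have ds : dist_preserving s by apply: dist_preservingM.
move=> N2 row_n [i2 [iN2 T2]].
have [r [c [B gE T]]] := near_min_board N2.
have [ir _ _] := row_turns0 B n_ge4 n_odd iN2 T2; rewrite ir in T2.
have [j0 [j2 jn gap0]] := gap B n_ge4 n_odd T2 T row_n.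
have [j02|j0n] := gap_ends B n_ge4 n_odd T2 T row_n j2 jn gap0.
  have gap2 j : 0 < j <= n -> hE (edge_image s E) n j = (j != 2) by rewrite -j02; exact: gap0.
  have [m [d [nm d1 _ F]]] := normal_form B n_ge4 n_odd T2 T row_n gap2.
  by exists s; split=> //; exists m, d.
set E2 := edge_image s E in N2 row_n B gE T T2 gap0 *.
pose t := (sym (true, false, false) * sym (false, true, false) * sym (true, false, false))%g.
have mE : mirror E2 = edge_image (s * t)%g E by rewrite /mirror /E2 !edge_imageM /t !mulgA.
have dt : dist_preserving t by do !apply: dist_preservingM; exact: sym_dist.
have N3 : near_min (mirror E2) by rewrite mE; apply: near_min_image NE; exact: dist_preservingM.
have [r' [c' [B' gE' T']]] := near_min_board N3.
have T2' : row_turns (hE (mirror E2)) n r = 0 by rewrite mirror_rows ?(board_r B).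
have [rr _ _] := row_turns0 B' n_ge4 n_odd (board_r B) T2'; rewrite rr in T2'.
have row_n' : row_turns (hE (mirror E2)) n n != 2 by rewrite mirror_rows.
(* The reflection sends edge index [j] to [n.+1 - j], so the gap at [n.-1] moves to [2]. *)
have gap2 j : 0 < j <= n -> hE (mirror E2) n j = (j != 2).
  by move=> jn'; rewrite mirror_h // gap0 ?j0n; lia.
have [m [d [nm d1 _ F]]] := normal_form B' n_ge4 n_odd T2' T' row_n' gap2.
by exists (s * t)%g; rewrite -mE; split=> //; [exact: dist_preservingM | exists m, d].
Qed.

End Symmetries.

Lemma cycle_on_pairs n (E : edge_set n.+1) s : cycle_on E s ->
  forall e, e \in E -> exists a b, e = [set a; b].
Proof. by case=> _ _ -> e /imsetP[x _ ->]; exists x, (next s x). Qed.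

Lemma sym_inj n : 0 < n -> injective (sym n).
Proof.
move=> n0 [[t f] g] [[t' f'] g'] e.
have e1 : sym n (t, f, g) (cl n 0 0) = sym n (t', f', g') (cl n 0 0) by rewrite e.
have e2 : sym n (t, f, g) (cl n 0 n) = sym n (t', f', g') (cl n 0 n) by rewrite e.
move: e1 e2; rewrite !sym_cl //= => /eqP + /eqP.
case: t t' f f' g g' {e} => [] [] [] [] [] [] //=; rewrite ?subn0 ?subnn ?cl_eq //; lia.
Qed.

(** * Rigidity of the spirals and the count of minimal cycles *)

Section Minimal.

Variable p : nat.
Hypothesis p0 : 0 < p.
Let m := p.+1.
Let n := m.*2.
Let n_ge4 : 4 <= n. Proof. by rewrite /n /m; lia. Qed.
Let n_gt0 : 0 < n. Proof. by []. Qed.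
Let n_gt1 : 1 < n. Proof. by []. Qed.

Lemma spiral_unique (E : edge_set n.+1) d : near_hamiltonian_cycle E -> d <= 1 ->
  (forall i j, i <= n -> j <= n -> hE E i j = hform m d i j /\ vE E i j = vform m d i j) ->
  E = spiral_edges p d.
Proof.
move=> [[s C] _] d1 F; have C' : cycle_on E s := C; have D := spiral_cycle_on p d1.
apply: (grid_ext (cycle_on_pairs C') (cycle_on_pairs D) (cycle_grid C') (cycle_grid D)) => i j
  iN jN.
by have [-> ->] := F i j iN jN; have [-> ->] := spiral_form d1 p0 iN jN.
Qed.

Lemma near_min_sym (E : edge_set n.+1) : near_min E ->
  exists q (d : bool), E = edge_image (sym n q) (spiral_edges p d).
Proof.
move=> NE; have n_odd : odd n.+1 by rewrite /= odd_double.
have [s [ds [NsE _] [k [d [nk d1 F]]]]] := normalize n_gt0 n_ge4 n_odd NE.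
have km : k = m by apply: double_inj.
rewrite km in F.
have [q eq] := dist_preserving_sym n_gt0 (dist_preservingV ds).
exists q, (d == 1); rewrite -eq.
have -> : (d == 1) = d :> nat by case: d d1 {F} => [|[]].
by rewrite -(spiral_unique NsE d1 F) edge_imageK.
Qed.

(* The edge joining (n, 1) to (n, 2) is the only border edge missing from the
   spirals, and every nontrivial symmetry moves it. *)
Lemma spiral_rigid s (d d' : bool) : dist_preserving s ->
  edge_image s (spiral_edges p d) = spiral_edges p d' -> s = 1%g /\ d = d'.
Proof.
move=> ds Es.
have [q sq] := dist_preserving_sym n_gt0 ds.
have d1 (b : bool) : b <= 1 by case: b.
pose gap (x y : cell n.+1) := [set sym n q x; sym n q y] = [set cl n n 1; cl n n 2].
have no_gap x y : gap x y -> [set x; y] \notin spiral_edges p d.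
  move=> g; rewrite -(edge_imageE (sym n q)) -sq Es sq g; apply/negP => e.
  have [] := spiral_form (d1 d') p0 (leqnn n) n_gt1.
  rewrite /hE e leqnn n_gt1 /= /hform /n /m.
  by case: (d') => /=; lia.
have noh i j : i <= n -> 0 < j <= n -> gap (cl n i j.-1) (cl n i j) -> ~~ hform m d i j.
  move=> iN /andP[j0 jN] /no_gap; have [<- _] := spiral_form (d1 d) p0 iN jN.
  by rewrite /hE iN j0 jN.
have nov i j : 0 < i <= n -> j <= n -> gap (cl n i.-1 j) (cl n i j) -> ~~ vform m d i j.
  move=> /andP[i0 iN] jN /no_gap; have [_ <-] := spiral_form (d1 d) p0 iN jN.
  by rewrite /vE i0 iN jN.
have s1 : s = 1%g.
  have n1 : n - n.-1 = 1 by lia.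
  have n2 : n - n.-1.-1 = 2 by lia.
  have [l0 l1 l2] : [/\ 0 < n.-1, n.-1 <= n & n.-1.-1 <= n] by split; lia.
  have dE := d1 d.
  (* Each [q] other than the identity is refuted by the edge that it carries onto the gap: this is a
     border edge present in both spirals. *)
  rewrite sq; case: q @gap {no_gap sq Es} noh nov => [[[] []] []] gap noh nov.
  - have /negP[] : ~~ vform m d n.-1 0; last by rewrite vformE; clear -dE p0; lia.
    by apply: nov; rewrite ?l0 ?l1 // /gap !sym_cl //= n1 n2 subn0 setUC.
  - have /negP[] : ~~ vform m d 2 0; last by rewrite vformE; clear -dE p0; lia.
    by apply: nov => //; rewrite /gap !sym_cl //= subn0.
  - have /negP[] : ~~ vform m d n.-1 n; last by rewrite vformE; clear -dE p0; lia.
    by apply: nov; rewrite ?l0 ?l1 // /gap !sym_cl //= n1 n2 setUC.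
  - have /negP[] : ~~ vform m d 2 n; last by rewrite vformE; clear -dE p0; lia.
    by apply: nov => //; rewrite /gap !sym_cl.
  - have /negP[] : ~~ hform m d 0 n.-1; last by rewrite /hform; clear -dE p0; lia.
    by apply: noh; rewrite ?l0 ?l1 // /gap !sym_cl //= n1 n2 subn0 setUC.
  - have /negP[] : ~~ hform m d 0 2; last by rewrite /hform; clear -dE p0; lia.
    by apply: noh => //; rewrite /gap !sym_cl //= subn0.
  - have /negP[] : ~~ hform m d n n.-1; last by rewrite /hform; clear -dE p0; lia.
    by apply: noh; rewrite ?l0 ?l1 // /gap !sym_cl //= n1 n2 setUC.
  - by apply/permP => a; rewrite symE perm1; case: a.
split=> //; move: Es; rewrite s1 edge_image1 => Es.
(* The vertical edge between rows [m] and [m.+1] in column [m] belongs to the spiral with [d = 1]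
   only. *)
have [_] := spiral_form (d1 d) p0 (ltac:(rewrite /n /m; lia) : m.+1 <= n) (ltac:(rewrite /n /m;
  lia) : m <= n).
have [_] := spiral_form (d1 d') p0 (ltac:(rewrite /n /m; lia) : m.+1 <= n) (ltac:(rewrite /n /m;
  lia) : m <= n).
rewrite Es => ->; rewrite !vformE; case: (d) (d') => [] []; lia.
Qed.

End Minimal.

Theorem theorem7 (R : realType) (k : nat) (k_odd : odd k) (k_ge5 : 5 <= k) :
  [/\ exists2 E : edge_set k, near_hamiltonian_cycle E & turns E = 2 * k,
      forall E : edge_set k, near_hamiltonian_cycle E -> 2 * k <= turns E
    & exists C : {set edge_set k},
      [/\ forall E : edge_set k,
            E \in C <-> near_hamiltonian_cycle E /\ turns E = 2 * k,
          #|C| = 16,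
          forall E : edge_set k, E \in C -> asymmetric R E
        & exists E1 E2 : edge_set k,
            [/\ E1 \in C, E2 \in C, ~ essentially_same R E1 E2
              & forall E : edge_set k, E \in C ->
                  essentially_same R E1 E \/ essentially_same R E2 E]]].
Proof.
have [p pk] : exists p, k = p.+1.*2.+1 by exists (k./2).-1; lia.
have p0 : 0 < p by lia.
subst k; set n := p.+1.*2 in k_odd k_ge5 *.
have d1 (b : bool) : b <= 1 by case: b.
split.
- by have [N T] := near_min_spiral (d1 false) p0; exists (spiral_edges p false).
- move=> E [[s C] H1]; have C' : cycle_on E s := C.
  have [r [c B]] := board_of_cycle (conj (ex_intro _ s C) H1).
  by rewrite (turns_rows B (cycle_grid C')) mul2n (turns_ge k_odd _ B).
(* Eight symmetries applied to two spirals give the sixteen cycles, which are distinct by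
   [spiral_rigid] and [sym_inj]. *)
pose f (x : (bool * bool * bool) * bool) : edge_set n.+1 :=
  edge_image (sym n x.1) (spiral_edges p x.2).
have n0 : 0 < n by [].
have f_inj : injective f.
  move=> [q d] [q' d'] e.
  have e' : edge_image (sym n q * (sym n q')^-1)%g (spiral_edges p d) = spiral_edges p d'.
    by rewrite -edge_imageM -[edge_image (sym n q) _]/(f (q, d)) e edge_imageK.
  have [|s1 ->] := spiral_rigid p0 _ e'; first by apply: dist_preservingM;
    [|apply: dist_preservingV]; apply: sym_dist.
  congr pair; apply: (sym_inj n0); by move/(canRL (mulgKV _)): s1; rewrite mul1g.
have fC E : E \in f @: setT -> near_min E.
  by case/imsetP => -[q d] _ ->; apply: near_min_image (sym_dist _) (near_min_spiral (d1 d) p0).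
exists (f @: setT); split.
- move=> E; split; first exact: fC.
  by move/(near_min_sym p0) => [q [d ->]]; apply/imsetP; exists (q, d).
- by rewrite card_imset // cardsT !card_prod !card_bool.
- move=> E /imsetP[[q d] _ ->] s bs e.
  (* A symmetry fixing an image of a spiral is conjugated to one fixing the spiral itself, which is
     trivial by rigidity. *)
  have e' : edge_image (sym n q * s * (sym n q)^-1)%g (spiral_edges p d) = spiral_edges p d.
    by rewrite -!edge_imageM e edge_imageK.
  have [|s1 _] := spiral_rigid p0 _ e'.
    apply: dist_preservingM; last exact: dist_preservingV (sym_dist _).
    by apply: dist_preservingM (sym_dist _) (board_symmetry_dist bs).
  have := congr1 (fun x => (sym n q)^-1 * x * sym n q)%g s1.
  by rewrite mulgA mulgKV mulKg mulg1 mulVg.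
have f1 q d : f (q, d) \in f @: setT by apply: imset_f.
have sym1 : sym n (false, false, false) = 1%g.
  by apply/permP => a; rewrite symE perm1; case: a.
exists (spiral_edges p false), (spiral_edges p true); split.
- by rewrite -[spiral_edges p false]edge_image1 -sym1; exact: f1 (false, false, false) false.
- by rewrite -[spiral_edges p true]edge_image1 -sym1; exact: f1 (false, false, false) true.
- by case=> s /board_symmetry_dist ds /esym /(spiral_rigid p0 ds)[].
- move=> E /imsetP[[q [] ] _ ->]; [right | left]; exists (sym n q) => //; exact: sym_board_symmetry.
Qed.
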